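(* Let $n\ge 1$, let $\Phi_{1},\Phi_{2}\in \mathcal{S}_{+,\mathrm{rat}}^{n\times n}(\mathbb{T})$ be two spectral densities of full normal rank, and let $W_{1},W_{2}\in\mathbb{R}^{n\times n}(z)$ denote the corresponding minimum-phase spectral factors. If $W_{2}^{-1}W_{1}$ has no zero and no pole on $\mathbb{T}$, then the Hilbert metric $d_H$ and the Thompson metric $d_T$ between $\Phi_{1}$ and $\Phi_{2}$ are given, respectively, by $$d_{H}(\Phi_{1},\Phi_{2})=\log\left( \left\|W_{2}^{-1}W_{1}\right\|_{\mathcal{H}_\infty}^{2}\left\|W_{1}^{-1}W_{2}\right\|_{\mathcal{H}_\infty}^{2}\right),$$ $$d_{T}(\Phi_{1},\Phi_{2})=\log \max\left\{\left\|W_{2}^{-1}W_{1}\right\|_{\mathcal{H}_\infty}^{2},\left\|W_{1}^{-1}W_{2}\right\|_{\mathcal{H}_\infty}^{2}\right\}.$$ Otherwise (that is, if $W_{2}^{-1}W_{1}$ has a zero or a pole on $\mathbb{T}$), $d_{H}(\Phi_{1},\Phi_{2})=d_{T}(\Phi_{1},\Phi_{2})=\infty$.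
   Context: $\mathbb{T}$ is the unit circle and $\mathbb{D}$ the open unit disk in the complex plane. $\mathbb{R}^{n\times m}(z)$ is the set of $n\times m$ matrices of rational functions of $z$ with real coefficients. For $A(z)\in\mathbb{R}^{n\times m}(z)$, $A^{*}(z):=A^{\top}(1/z)$ (on $\mathbb{T}$ this is the Hermitian transpose). Let $\mathcal{L}_2^n[-\pi,\pi]$ be the Hilbert space of square integrable $\mathbb{C}^n$-valued functions on $\mathbb{T}$ with $\langle f,g\rangle_2=\int_{-\pi}^{\pi} f(e^{j\theta})^*g(e^{j\theta})\frac{d\theta}{2\pi}$, where $j$ is the imaginary unit. Spectral densities: $\mathcal{S}_{+}^{n\times n}(\mathbb{T})$ is the cone of bounded functions $\Phi:\mathbb{T}\to\mathbb{C}^{n\times n}$ with $\Phi(e^{j\theta})=\Phi(e^{j\theta})^*$ for all $\theta$ and $\langle f,\Phi f\rangle_2\ge 0$ for all $f\in\mathcal{L}_2^n[-\pi,\pi]$. $\mathcal{S}_{+,\mathrm{rat}}^{n\times n}(\mathbb{T})$ is the subset of those $\Phi$ that are real rational, i.e. restrictions to $\mathbb{T}$ of elements of $\mathbb{R}^{n\times n}(z)$ (bounded on $\mathbb{T}$). The normal rank of $\Phi$ is its almost-everywhere rank on $\mathbb{T}$; full normal rank means normal rank $n$. Minimum-phase spectral factor: a rational $W(z)\in\mathbb{R}^{n\times r}(z)$ is a spectral factor of $\Phi$ if $\Phi(z)=W(z)W^{*}(z)$. It is minimum-phase if it is analytic in an open set containing the complement of $\mathbb{D}$ and its (generalized) inverse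 is analytic in the complement of the closure of $\mathbb{D}$; complements are taken in the extended complex plane $\mathbb{C}\cup\{\infty\}$. For a rational spectral density of normal rank $r$ a minimum-phase spectral factor in $\mathbb{R}^{n\times r}(z)$ exists and is unique up to right multiplication by a real orthogonal $r\times r$ matrix; in the full normal rank case $r=n$ and the generalized inverse is the ordinary inverse. Poles and zeros of a rational matrix are meant in the usual (Smith–McMillan) sense; for an invertible square rational matrix $G$, a zero of $G$ is a pole of $G^{-1}$. $\mathcal{H}_\infty$-norm: $\|G\|_{\mathcal{H}_\infty}:=\sup_{z\in\mathbb{C},\,|z|>1}\sigma_{\max}(G(z))$, where $\sigma_{\max}$ is the largest singular value. Hilbert and Thompson metrics: for nonzero $\Phi,\Psi\in\mathcal{S}_{+}^{n\times n}(\mathbb{T})$ write $\Phi\le\Psi$ if $\Psi-\Phi\in\mathcal{S}_{+}^{n\times n}(\mathbb{T})$. Put $M(\Phi,\Psi):=\inf\{\lambda\in\mathbb{R}:\Phi\le\lambda\Psi\}$ if this set is non-empty, $M(\Phi,\Psi):=\infty$ otherwise, and $m(\Phi,\Psi):=\sup\{\mu\in\mathbb{R}:\mu\Psi\le\Phi\}=1/M(\Psi,\Phi)$. Write $\Phi\sim\Psi$ if there are $\beta,\beta'>0$ with $\Phi\le\beta\Psi$ and $\Psi\le\beta'\Phi$. If $\Phi\sim\Psi$, then $$d_H(\Phi,\Psi):=\log\frac{M(\Phi,\Psi)}{m(\Phi,\Psi)},\qquad d_T(\Phi,\Psi):=\log\max\{M(\Phi,\Psi),M(\Psi,\Phi)\};$$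 otherwise $d_H(\Phi,\Psi)=d_T(\Phi,\Psi):=\infty$. *)

(* Defs.v *)
From HB Require Import structures.
From mathcomp Require Import all_boot all_order all_algebra.
From mathcomp Require Import complex.
From mathcomp Require Import all_classical all_reals all_analysis.

Set Implicit Arguments.
Unset Strict Implicit.
Unset Printing Implicit Defensive.

Import Order.TTheory GRing.Theory Num.Theory.
Import numFieldNormedType.Exports.
Local Open Scope classical_set_scope.
Local Open Scope complex_scope.
Local Open Scope ring_scope.
Local Open Scope sesquilinear_scope.

(* The field R(z) of rational functions with real coefficients. *)
Notation ratfun R := {fraction {poly R}}.

Section RationalFunctions.
Variable R : realType.
Local Notation C := R[i].

(* Value of f at z through a reduced fraction p / q.  At a pole it is 0, since
   x / 0 = 0; the resulting function is discontinuous and unbounded there, so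
   this convention never makes a pole look like a regular point. *)
Definition rat_eval (f : ratfun R) (z : C) : C :=
  let: (p, q) := frac (generic_quotient.repr f) in
  let g := gcdp p q in
  (map_poly (real_complex R) (p %/ g)).[z] /
  (map_poly (real_complex R) (q %/ g)).[z].

Definition rat_evalmx m n (A : 'M[ratfun R]_(m, n)) (z : C) : 'M[C]_(m, n) :=
  map_mx (rat_eval^~ z) A.

(* f(z) |-> f(1/z) *)
Definition rat_recip (f : ratfun R) : ratfun R :=
  let: (p, q) := frac (generic_quotient.repr f) in
  let zinv : ratfun R := (tofrac 'X)^-1 in
  (map_poly (fun c : R => tofrac c%:P) p).[zinv] /
  (map_poly (fun c : R => tofrac c%:P) q).[zinv].

(* A^*(z) = A^T(1/z) *)
Definition para_adj m n (A : 'M[ratfun R]_(m, n)) : 'M[ratfun R]_(n, m) :=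
  (map_mx rat_recip A)^T.

(* Extended complex plane: None is the point at infinity. *)
Definition ext_plane : topologicalType := one_point_compactification C^o.

Definition rat_differentiable_at (f : ratfun R) (x : ext_plane) : Prop :=
  match x with
  | Some z => derivable (rat_eval f : C^o -> C^o) z 1
  | None => derivable (rat_eval (rat_recip f) : C^o -> C^o) 0 1
  end.

(* To be used for open U. *)
Definition analytic_on m n (A : 'M[ratfun R]_(m, n)) (U : set ext_plane) : Prop :=
  forall x, U x -> forall i j, rat_differentiable_at (A i j) x.

(* Complements, in the extended plane, of the open unit disk and of its
   closure. *)
Definition compl_disk : set ext_plane :=
  [set x : ext_plane | if x is Some z then 1 <= `|z : C| else True].
Definition compl_closed_disk : set ext_plane :=
  [set x : ext_plane | if x is Some z then 1 < `|z : C| else True].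

Definition spectral_factor n r (Phi : 'M[ratfun R]_n)
    (W : 'M[ratfun R]_(n, r)) : Prop :=
  Phi = W *m para_adj W.

(* Square W of full normal rank, so that the generalized inverse is invmx W. *)
Definition minimum_phase n (W : 'M[ratfun R]_n) : Prop :=
  (exists U : set ext_plane,
     [/\ open U, compl_disk `<=` U & analytic_on W U]) /\
  analytic_on (invmx W) compl_closed_disk.

(* Smith-McMillan form: G = U D V with U and V unimodular, where D is zero
   outside its leading r diagonal entries eps_k / psi_k. *)
Definition smith_mcmillan m n (G : 'M[ratfun R]_(m, n)) (r : nat)
    (eps psi : nat -> {poly R}) : Prop :=
  [/\ (r <= minn m n)%N,
      forall k, (k < r)%N ->
        [/\ eps k \is monic, psi k \is monic & coprimep (eps k) (psi k)],
      forall k l, (k <= l < r)%N -> eps k %| eps l /\ psi l %| psi k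
    & exists (U : 'M[{poly R}]_m) (V : 'M[{poly R}]_n),
        [/\ U \in unitmx, V \in unitmx &
            G = map_mx (@tofrac _) U *m
                (\matrix_(i, j) if (i == j :> nat) && (i < r)%N
                                then tofrac (eps i) / tofrac (psi i) else 0) *m
                map_mx (@tofrac _) V]].

Definition is_pole m n (G : 'M[ratfun R]_(m, n)) (z : C) : Prop :=
  exists r eps psi, smith_mcmillan G r eps psi /\
    exists2 k, (k < r)%N & root (map_poly (real_complex R) (psi k)) z.

Definition is_zero m n (G : 'M[ratfun R]_(m, n)) (z : C) : Prop :=
  exists r eps psi, smith_mcmillan G r eps psi /\
    exists2 k, (k < r)%N & root (map_poly (real_complex R) (eps k)) z.

Definition singular_values m n (A : 'M[C]_(m, n)) : set R :=
  [set s | 0 <= s /\ eigenvalue (A ^t* *m A) (s ^+ 2)%:C].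

Definition sigma_max m n (A : 'M[C]_(m, n)) : R := sup (singular_values A).

Definition Hinf_norm m n (G : 'M[ratfun R]_(m, n)) : \bar R :=
  ereal_sup [set (sigma_max (rat_evalmx G z))%:E | z in [set z : C | 1 < `|z|]].

End RationalFunctions.

Section SpectralDensities.
Variable R : realType.
Local Notation C := R[i].
Local Notation mu := (@lebesgue_measure R).

Definition unit_circle : set C := [set z | `|z| = 1].

(* e^{j theta} *)
Definition cis (t : R) : C := cos t +i* sin t.

(* A function on the unit circle is represented by a function on C, of which
   only the values on the circle are ever used. *)

Definition angles : set R := [set` `[- pi, pi]].

Definition circle_measurable (g : C -> C) : Prop :=
  measurable_fun angles (fun t : R => complex.Re (g (cis t))) /\
  measurable_fun angles (fun t : R => complex.Im (g (cis t))).

Definition circle_integral (g : C -> C) : C :=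
  ((\int[mu]_(t in angles) complex.Re (g (cis t))) / (2 * pi)) +i*
  ((\int[mu]_(t in angles) complex.Im (g (cis t))) / (2 * pi)).

Definition L2 n (f : C -> 'cV[C]_n) : Prop :=
  (forall i, circle_measurable (fun z => f z i 0)) /\
  (\int[mu]_(t in angles)
     (complex.Re (((f (cis t)) ^t* *m f (cis t)) 0 0))%:E < +oo)%E.

Definition inner2 n (f g : C -> 'cV[C]_n) : C :=
  circle_integral (fun z => ((f z) ^t* *m g z) 0 0).

(* Measurability is implicit in the use of <f, Phi f>_2.  The order on C is the
   partial one: 0 <= w means that w is real and nonnegative. *)
Definition Splus n (Phi : C -> 'M[C]_n) : Prop :=
  [/\ forall i j, circle_measurable (fun z => Phi z i j),
      exists B : R, forall z, unit_circle z ->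
        forall i j, `|Phi z i j| <= B%:C,
      forall z, unit_circle z -> (Phi z) ^t* = Phi z
    & forall f : C -> 'cV[C]_n, L2 f -> 0 <= inner2 f (fun z => Phi z *m f z)].

(* A real rational function is identified with its restriction to the circle,
   which determines it.  Boundedness excludes poles on the circle. *)
Definition Splus_rat n (Phi : 'M[ratfun R]_n) : Prop := Splus (rat_evalmx Phi).

Definition normal_rank n (Phi : C -> 'M[C]_n) (r : nat) : Prop :=
  {ae mu, forall t : R, angles t -> \rank (Phi (cis t)) = r}.

Definition Sle n (Phi Psi : C -> 'M[C]_n) : Prop :=
  Splus (fun z => Psi z - Phi z).

Definition Sscale n (l : R) (Phi : C -> 'M[C]_n) : C -> 'M[C]_n :=
  fun z => l%:C *: Phi z.

(* The infimum of the empty set is +oo. *)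
Definition upperM n (Phi Psi : C -> 'M[C]_n) : \bar R :=
  ereal_inf [set l%:E | l in [set l : R | Sle Phi (Sscale l Psi)]].

Definition lowerm n (Phi Psi : C -> 'M[C]_n) : \bar R :=
  ereal_sup [set l%:E | l in [set l : R | Sle (Sscale l Psi) Phi]].

Definition Sequiv n (Phi Psi : C -> 'M[C]_n) : Prop :=
  exists b b' : R,
    [/\ 0 < b, 0 < b', Sle Phi (Sscale b Psi) & Sle Psi (Sscale b' Phi)].

Definition hilbert_metric n (Phi Psi : C -> 'M[C]_n) : \bar R :=
  if `[< Sequiv Phi Psi >]
  then lne (upperM Phi Psi / lowerm Phi Psi)%E else +oo%E.

Definition thompson_metric n (Phi Psi : C -> 'M[C]_n) : \bar R :=
  if `[< Sequiv Phi Psi >]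
  then lne (maxe (upperM Phi Psi) (upperM Psi Phi)) else +oo%E.

End SpectralDensities.

(* Main.v *)
Require Import Defs.
From HB Require Import structures.
From mathcomp Require Import all_boot all_order all_algebra all_fingroup.
From mathcomp Require Import complex.
From mathcomp Require Import ring lra.
From mathcomp Require Import all_classical all_reals all_analysis.
From mathcomp Require Import measurable_realfun.

Set Implicit Arguments.
Unset Strict Implicit.
Unset Printing Implicit Defensive.

Import Order.TTheory GRing.Theory Num.Theory.
Import numFieldNormedType.Exports.
Local Open Scope classical_set_scope.
Local Open Scope complex_scope.
Local Open Scope ring_scope.

(** Write G = W2^-1 W1 and H = W1^-1 W2 = G^-1.  On the unit circle 1/z is the
    conjugate of z, so the densities take the values W_i(z) W_i(z)^* there, and
    Phi1 <= l Phi2 amounts to |W1(z)^* v|^2 <= l |W2(z)^* v|^2 for all v and all z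
    on the circle ([Splus_pointwise], [Sle_pointwise]).  With v = W2(z)^-* u this
    reads |G(z)^* u|^2 <= l |u|^2, that is, the squared operator norm of G(z) is
    at most l ([dominance_opbound]).  The substitution is only possible where W2
    is invertible, at all but finitely many points of the circle; but a rational
    function that is bounded near a point cannot have a pole there
    ([bounded_regular]), so the domination itself forces G to be regular on the
    whole circle, and the norm bound extends by continuity.

    If G has a pole or a zero on the circle, then G or H is not regular there, so
    one of the two dominations fails for every constant and both metrics are
    infinite ([regular_pole], [regular_zero]).

    Otherwise G is regular on the circle.  Minimum phase makes W1 and the inverse
    of W2 regular outside the closed disk and at infinity, so G is regular on the
    complement of the open disk in the extended plane.  The substitution w = 1/z
    turns every coefficient u^* G(z) w of G into a quotient of polynomials whose
    denominator has no zero in the closed unit disk, and the maximum principle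
    ([maximum_principle]) shows that a bound on the circle is the same as a bound
    on |z| > 1 ([opbound_outside]).  Hence the constants l with Phi1 <= l Phi2 are
    exactly those with l >= ||G||^2 in the H-infinity norm ([Hinf_norm_bounds]), so
    M(Phi1, Phi2) = ||G||^2, and by symmetry m(Phi1, Phi2) = 1 / ||H||^2.

    The absence of zeros and poles is a statement about all Smith-McMillan forms
    of G.  To draw from it that G and H are regular, one such form has to be
    exhibited ([smith_mcmillan_exists]), which rests on the Smith form of a
    polynomial matrix ([smith_form]). *)

(** * Smith form of a polynomial matrix *)

Section SmithForm.
Variable F : fieldType.

Definition mx_equiv n (M N : 'M[{poly F}]_n) : Prop :=
  exists U V : 'M[{poly F}]_n,
    [/\ U \in unitmx, V \in unitmx & M = U *m N *m V].

Lemma mx_equiv_refl n (M : 'M[{poly F}]_n) : mx_equiv M M.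
Proof.
by exists 1%:M, 1%:M; rewrite unitmx1 mulmx1 mul1mx.
Qed.

Lemma mx_equiv_sym n (M N : 'M[{poly F}]_n) : mx_equiv M N -> mx_equiv N M.
Proof.
move=> [U [V [uU uV ->]]]; exists (invmx U), (invmx V).
by rewrite !unitmx_inv uU uV -!mulmxA mulmxV // mulmx1 mulKmx.
Qed.

Lemma mx_equiv_trans n (M N P : 'M[{poly F}]_n) :
  mx_equiv M N -> mx_equiv N P -> mx_equiv M P.
Proof.
move=> [U [V [uU uV ->]]] [U' [V' [uU' uV' ->]]].
exists (U *m U'), (V' *m V); rewrite !unitmx_mul uU uU' uV uV'.
by split => //; rewrite !mulmxA.
Qed.

Lemma mx_equiv_mull n (U M : 'M[{poly F}]_n) : U \in unitmx ->
  mx_equiv (U *m M) M.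
Proof. by move=> uU; exists U, 1%:M; rewrite unitmx1 mulmx1. Qed.

Lemma mx_equiv_mulr n (V M : 'M[{poly F}]_n) : V \in unitmx ->
  mx_equiv (M *m V) M.
Proof. by move=> uV; exists 1%:M, V; rewrite unitmx1 mul1mx. Qed.

Lemma mx_equiv_tr n (M N : 'M[{poly F}]_n) :
  mx_equiv M N -> mx_equiv M^T N^T.
Proof.
move=> [U [V [uU uV ->]]]; exists V^T, U^T.
by rewrite !unitmx_tr uU uV !trmx_mul mulmxA.
Qed.

Lemma mx_equiv_xrow n (i j : 'I_n) (M : 'M[{poly F}]_n) :
  mx_equiv (xrow i j M) M.
Proof. by rewrite xrowE; apply/mx_equiv_mull/unitmx_perm. Qed.

Lemma mx_equiv_xcol n (i j : 'I_n) (M : 'M[{poly F}]_n) :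
  mx_equiv (xcol i j M) M.
Proof. by rewrite xcolE; apply/mx_equiv_mulr/unitmx_perm. Qed.

(** Carries the divisibility chain of the invariant factors through the induction
    in [smith_form]. *)
Lemma mx_equiv_dvd n (M N : 'M[{poly F}]_n) (a : {poly F}) :
  mx_equiv M N -> (forall i j, a %| N i j) -> forall i j, a %| M i j.
Proof.
move=> [U [V [_ _ ->]]] dvN i j; rewrite !mxE.
apply: (big_ind (fun x => a %| x)) => [|x y ax ay|k _]; first exact: dvdp0.
  exact: dvdp_add.
apply/dvdp_mulr; rewrite !mxE.
apply: (big_ind (fun x => a %| x)) => [|x y ax ay|l _]; first exact: dvdp0.
  exact: dvdp_add.
exact/dvdp_mull.
Qed.

(** A corner entry of least size within the equivalence class: the remainders
    of Euclidean division by it cannot be nonzero, which forces divisibility. *)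
Definition min_corner n (M : 'M[{poly F}]_n.+1) : Prop :=
  M 0 0 != 0 /\
  forall N, mx_equiv N M -> N 0 0 != 0 -> (size (M 0 0)%R <= size (N 0 0)%R)%N.

Lemma exists_min_corner n (M : 'M[{poly F}]_n.+1) : M != 0 ->
  exists2 N, mx_equiv N M & min_corner N.
Proof.
move=> M0.
have [N0 [eN0 N00]] : exists N0, mx_equiv N0 M /\ N0 0 0 != 0.
  have /matrix0Pn[i [j Mij]] := M0.
  exists (xcol 0 j (xrow 0 i M)); split.
    exact: mx_equiv_trans (mx_equiv_xcol _ _ _) (mx_equiv_xrow _ _ _).
  by rewrite !mxE !tpermL.
move: {2}(size _) (leqnn (size (N0 0 0)%R)) => k.
elim: k N0 eN0 N00 => [|k IHk] N0 eN0 N00.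
  by rewrite leqn0 size_poly_eq0 (negPf N00).
move=> szN0.
have [[N [eN NN szN]]|minN0] :=
    boolp.pselect (exists N, [/\ mx_equiv N M, N 0 0 != 0 & (size (N 0 0)%R <= k)%N]).
- exact: IHk eN NN szN.
- exists N0 => //; split=> // N eN NN.
  rewrite (leq_trans szN0)// ltnNge; apply/negP => szN.
  apply: minN0; exists N; split=> //; exact: mx_equiv_trans eN eN0.
Qed.

Lemma min_corner_equiv n (M N : 'M[{poly F}]_n.+1) :
  mx_equiv N M -> N 0 0 = M 0 0 -> min_corner M -> min_corner N.
Proof.
move=> eN N00 [M0 minM]; split; first by rewrite N00.
move=> P eP P0; rewrite N00; apply: minM => //; exact: mx_equiv_trans eP eN.
Qed.

(** A row operation replaces the entry by its remainder modulo the corner, and a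
    swap brings the remainder to the corner: if it were nonzero it would
    contradict minimality. *)
Lemma min_corner_dvd_col n (M : 'M[{poly F}]_n.+1) i :
  min_corner M -> M 0 0 %| M i 0.
Proof.
move=> [M0 minM]; have [->//|i0] := eqVneq i 0.
pose U : 'M[{poly F}]_n.+1 := 1%:M - (M i 0 %/ M 0 0) *: delta_mx i 0.
have uU : U \in unitmx.
  suff /mulmx1_unit[] : U *m (1%:M + (M i 0 %/ M 0 0) *: delta_mx i 0) = 1%:M by [].
  rewrite mulmxBl mul1mx mulmxDr mulmx1 -scalemxAl -scalemxAr mul_delta_mx_0 1?eq_sym//.
  by rewrite !scaler0 addr0 addrK.
have Ui j : (U *m M) i j = M i j - M i 0 %/ M 0 0 * M 0 j.
  rewrite mulmxBl mul1mx -scalemxAl !mxE (bigD1 0)//= big1 ?addr0 => [|k k0].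
    by rewrite !mxE !eqxx mul1r.
  by rewrite !mxE (negPf k0) andbF mul0r.
have Ui0 : (U *m M) i 0 = M i 0 %% M 0 0.
  by rewrite Ui {1}(divp_eq (M i 0) (M 0 0)) addrAC subrr add0r.
apply: contraT => ndv; suff : (size (M 0 0)%R <= size (M i 0 %% M 0 0)%R)%N.
  by rewrite leqNgt ltn_modp M0.
have := minM (xrow 0 i (U *m M)); rewrite !mxE tpermL.
have -> : \sum_j U i j * M j 0 = (U *m M) i 0 by rewrite !mxE.
rewrite Ui0; apply; last exact: ndv.
exact: mx_equiv_trans (mx_equiv_xrow _ _ _) (mx_equiv_mull _ uU).
Qed.

Lemma min_corner_tr n (M : 'M[{poly F}]_n.+1) : min_corner M -> min_corner M^T.
Proof.
move=> [M0 minM]; split; rewrite mxE // => N eN N0.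
by have := minM N^T; rewrite mxE; apply => //; rewrite -[M]trmxK; exact: mx_equiv_tr.
Qed.

Lemma min_corner_dvd_row n (M : 'M[{poly F}]_n.+1) j :
  min_corner M -> M 0 0 %| M 0 j.
Proof. by move=> /min_corner_tr/(@min_corner_dvd_col _ _ j); rewrite !mxE. Qed.

(** Once the corner divides its row and column, elementary operations clear
    both. *)
Lemma min_corner_block n (M : 'M[{poly F}]_(1 + n)) :
  min_corner (M : 'M[{poly F}]_(n.+1)) ->
  exists N : 'M[{poly F}]_n,
    mx_equiv (block_mx (M 0 0)%:M 0 0 N : 'M[{poly F}]_(1 + n)) M.
Proof.
move=> cM.
pose c : 'cV[{poly F}]_n := \col_i (M (rshift 1 i) 0 %/ M 0 0).
pose b : 'rV[{poly F}]_n := \row_j (M 0 (rshift 1 j) %/ M 0 0).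
have l0 : lshift n (0 : 'I_1) = 0 by apply/val_inj.
have eM : M = block_mx (M 0 0)%:M ((M 0 0) *: b) ((M 0 0) *: c) (drsubmx M).
  rewrite -[LHS]submxK; congr block_mx; apply/matrixP => i j; rewrite !mxE ?ord1 ?l0.
  - by [].
  - by rewrite mulrC divpK// (min_corner_dvd_row (rshift 1 j : 'I_n.+1)).
  - by rewrite mulrC divpK// (min_corner_dvd_col (rshift 1 i : 'I_n.+1)).
pose L : 'M[{poly F}]_(1 + n) := block_mx 1%:M 0 (- c) 1%:M.
pose U : 'M[{poly F}]_(1 + n) := block_mx 1%:M (- b) 0 1%:M.
have uL : L \in unitmx by rewrite unitmxE det_lblock !det1 mulr1 unitr1.
have uU : U \in unitmx by rewrite unitmxE det_ublock !det1 mulr1 unitr1.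
exists (drsubmx M - c *m (M 0 0 *: b)).
have -> : block_mx (M 0 0)%:M 0 0 (drsubmx M - c *m (M 0 0 *: b)) = L *m M *m U.
  rewrite {4}eM !mulmx_block !mul1mx !mul0mx !addr0 !mulmx1 !mulmx0 ?addr0.
  rewrite !mulmxN !mulNmx !mul_scalar_mx !mul_mx_scalar !addNr mul0mx oppr0 add0r.
  by congr block_mx; rewrite addrC.
exact: mx_equiv_trans (mx_equiv_mulr _ uU) (mx_equiv_mull _ uL).
Qed.

Lemma block_mx00 (A : Type) n (a : 'M[A]_1) (b : 'rV[A]_n) (c : 'cV[A]_n) (N : 'M[A]_n) :
  (block_mx a b c N : 'M[A]_(n.+1)) 0 0 = a 0 0.
Proof.
by rewrite -[RHS](block_mxEul _ b c N); congr fun_of_matrix; apply/val_inj.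
Qed.

Lemma block_mx0r (A : Type) n (a : 'M[A]_1) (b : 'rV[A]_n) (c : 'cV[A]_n) (N : 'M[A]_n) j :
  (block_mx a b c N : 'M[A]_(n.+1)) 0 (rshift 1 j) = b 0 j.
Proof.
by rewrite -[RHS](block_mxEur a _ c N); congr fun_of_matrix; apply/val_inj.
Qed.

(** Adding row i of the block to the first row keeps the corner and places the
    entries of that row where the corner is known to divide. *)
Lemma min_corner_dvd_block n (a : {poly F}) (N : 'M[{poly F}]_n) :
  min_corner (block_mx a%:M 0 0 N : 'M[{poly F}]_(1 + n)) -> forall i j, a %| N i j.
Proof.
set B : 'M[{poly F}]_(1 + n) := block_mx _ _ _ _ => cB i j.
pose U : 'M[{poly F}]_(1 + n) := block_mx 1%:M (delta_mx 0 i) 0 1%:M.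
have uU : U \in unitmx by rewrite unitmxE det_ublock !det1 mulr1 unitr1.
have eU : U *m B = block_mx a%:M (row i N) 0 N.
  by rewrite mulmx_block !mul1mx !mul0mx !mulmx0 !addr0 !add0r -rowE.
have c1 : (block_mx a%:M (row i N) 0 N : 'M[{poly F}]_(1 + n)) 0 0 = a.
  by rewrite block_mx00 mxE.
have c2 : B 0 0 = a by rewrite block_mx00 mxE.
have cU : min_corner (U *m B : 'M[{poly F}]_(n.+1)).
  apply: min_corner_equiv cB; first exact: mx_equiv_mull.
  by rewrite eU c1 c2.
have := min_corner_dvd_row (rshift 1 j : 'I_n.+1) cU.
by rewrite eU c1 block_mx0r mxE.
Qed.

Definition smith_diag n (r : nat) (d : nat -> {poly F}) : 'M[{poly F}]_n :=
  \matrix_(i, j) if (i == j :> nat) && (i < r)%N then d i else 0.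

(** Induction on the size: a minimal corner splits off and divides the remaining
    block, hence all later invariant factors. *)
Lemma smith_form n (M : 'M[{poly F}]_n) :
  exists (r : nat) (d : nat -> {poly F}),
    [/\ (r <= n)%N, forall k, (k < r)%N -> d k \is monic,
        forall k l, (k <= l < r)%N -> d k %| d l & mx_equiv M (smith_diag n r d)].
Proof.
elim: n M => [|n IHn] M.
  exists 0%N, (fun=> 1); split=> //.
  by rewrite [M]flatmx0 [smith_diag _ _ _]flatmx0; exact: mx_equiv_refl.
have [->|M0] := eqVneq M 0.
  exists 0%N, (fun=> 1); split=> //.
  suff -> : smith_diag n.+1 0 (fun=> 1) = 0 by exact: mx_equiv_refl.
  by apply/matrixP => i j; rewrite !mxE ltn0 andbF.
have [N eN cN] := exists_min_corner M0.
have [N' eN'] := min_corner_block cN.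
set a := N 0 0 in eN'; have a0 : a != 0 by have [] := cN.
have cB : min_corner (block_mx a%:M 0 0 N' : 'M[{poly F}]_(1 + n)).
  apply: min_corner_equiv eN' _ cN.
  by rewrite block_mx00 mxE.
have [r [d [rn dmon ddvd [U [V [uU uV eN'E]]]]]] := IHn N'.
pose b := (lead_coef a)^-1 *: a.
have lca : lead_coef a != 0 by rewrite lead_coef_eq0.
(* The new invariant factor b is the corner made monic; its leading coefficient
   goes into the left unimodular factor. *)
exists r.+1, (fun k => if k is k'.+1 then d k' else b); split=> //.
- move=> [_|k]; last exact: dmon.
  by rewrite monicE lead_coefZ mulVf.
- move=> [|k] [|l] //=; last exact: ddvd.
  rewrite ltnS => lr; rewrite dvdpZl ?invr_eq0 //.
  have := @mx_equiv_dvd _ (smith_diag n r d) N' a _ (min_corner_dvd_block cB)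
    (Ordinal (leq_trans lr rn)) (Ordinal (leq_trans lr rn)).
  rewrite mxE eqxx /= lr; apply.
  by apply: mx_equiv_sym; exists U, V.
apply: mx_equiv_trans (mx_equiv_sym eN) _.
apply: mx_equiv_trans (mx_equiv_sym eN') _.
pose U' : 'M[{poly F}]_(1 + n) := block_mx (lead_coef a)%:P%:M 0 0 U.
pose V' : 'M[{poly F}]_(1 + n) := block_mx 1%:M 0 0 V.
exists U', V'; split.
- rewrite unitmxE det_ublock det_scalar1 unitrM -unitmxE uU andbT.
  by rewrite poly_unitE size_polyC lca coefC eqxx unitfE.
- by rewrite unitmxE det_ublock det1 mul1r -unitmxE.
have -> : smith_diag n.+1 r.+1 (fun k => if k is k'.+1 then d k' else b) =
          block_mx b%:M 0 0 (smith_diag n r d) :> 'M[{poly F}]_(1 + n).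
  apply/matrixP => i j; case: (split_ordP i) => i' ->; case: (split_ordP j) => j' ->.
  - by rewrite block_mxEul !mxE /= !ord1.
  - by rewrite block_mxEur !mxE /= !ord1.
  - by rewrite block_mxEdl !mxE /= !ord1.
  - by rewrite block_mxEdr !mxE.
rewrite !mulmx_block !mul0mx !mulmx0 !addr0 !add0r !mulmx1 ?mulmx0 ?mul0mx.
by rewrite -eN'E -scalar_mxM mul_polyC scalerA mulfV // scale1r.
Qed.
End SmithForm.

(** * Smith-McMillan form of a rational matrix *)

Section Fractions.
Local Open Scope quotient_scope.

Lemma frac_repr (D : idomainType) (f : {fraction D}) :
  f = tofrac (generic_quotient.repr f).1 / tofrac (generic_quotient.repr f).2.
Proof.
set x := generic_quotient.repr f.
have d0 : tofrac x.2 != 0 :> {fraction D} by rewrite tofrac_eq0 denom_ratioP.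
apply: (mulIf d0); rewrite divfK // -[f in LHS]reprK -/x.
unlock FracField.tofrac; rewrite -[LHS]FracField.pi_mul.
apply/eqmodP; rewrite /= FracField.equivfE /FracField.mulf.
by rewrite !numden_Ratio ?mulr1 ?oner_neq0 ?denom_ratioP // mulrC.
Qed.

Lemma common_denominator (D : idomainType) m n (A : 'M[{fraction D}]_(m, n)) :
  exists (d : D) (N : 'M[D]_(m, n)),
    d != 0 /\ A = (tofrac d)^-1 *: map_mx (@tofrac D) N.
Proof.
pose q i j := (generic_quotient.repr (A i j)).2.
have q0 i j : q i j != 0 by exact: denom_ratioP.
pose d := \prod_(ij : 'I_m * 'I_n) q ij.1 ij.2.
have d0 : d != 0 by apply/prodf_neq0 => ij _; exact: q0.
pose c i j := \prod_(ij | ij != (i, j)) q ij.1 ij.2.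
exists d, (\matrix_(i, j) ((generic_quotient.repr (A i j)).1 * c i j)).
split=> //; apply/matrixP => i j; rewrite !mxE.
have dE : d = q i j * c i j by rewrite /d (bigD1 (i, j)).
rewrite {1}[A i j]frac_repr dE !tofracM -/(q i j).
have c0 : tofrac (c i j) != 0 :> {fraction D}.
  by move: d0; rewrite tofrac_eq0 dE mulf_eq0 negb_or => /andP[].
by rewrite invfM mulrACA mulVf // mulr1 mulrC.
Qed.

End Fractions.

Section SmithMcMillan.
Variable R : realType.

(** Put the matrix over one monic denominator d, take the Smith form of the
    numerator and cancel gcd(s_k, d) in each s_k / d.  The divisibility chains
    survive: writing gcd(s_l, d) = h gcd(s_k, d), the polynomial h divides the
    denominator of s_k / d, which is coprime to its numerator. *)
Lemma smith_mcmillan_exists n (G : 'M[ratfun R]_n) :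
  exists r eps psi, smith_mcmillan G r eps psi.
Proof.
have [d0 [N [d0_neq0 GE]]] := common_denominator G.
have [r [s [rn smon sdvd [U [V [uU uV NE]]]]]] := smith_form N.
pose d : {poly R} := (lead_coef d0)^-1 *: d0.
have lc0 : lead_coef d0 != 0 by rewrite lead_coef_eq0.
have dmon : d \is monic by rewrite monicE lead_coefZ mulVf.
have d_neq0 : d != 0 by exact: monic_neq0.
pose g k : {poly R} := (lead_coef (gcdp (s k) d))^-1 *: gcdp (s k) d.
have gcd0 k : gcdp (s k) d != 0 by rewrite gcdp_eq0 (negPf d_neq0) andbF.
have gmon k : g k \is monic by rewrite monicE lead_coefZ mulVf ?lead_coef_eq0.
have geq k : g k %= gcdp (s k) d.
  by apply: eqp_scale; rewrite invr_eq0 lead_coef_eq0.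
have g0 k : g k != 0 by exact: monic_neq0.
have gs k : g k %| s k by rewrite (eqp_dvdl _ (geq k)) dvdp_gcdl.
have gd k : g k %| d by rewrite (eqp_dvdl _ (geq k)) dvdp_gcdr.
pose eps k : {poly R} := s k %/ g k; pose psi k : {poly R} := d %/ g k.
have epsg k : eps k * g k = s k by exact: divpK.
have psig k : psi k * g k = d by exact: divpK.
have cop k : coprimep (eps k) (psi k).
  have : g k * gcdp (eps k) (psi k) %= g k * 1.
    have := mulp_gcdr (eps k) (psi k) (g k).
    have -> : g k * eps k = s k by rewrite mulrC epsg.
    have -> : g k * psi k = d by rewrite mulrC psig.
    by move=> /eqp_trans; apply; rewrite mulr1 eqp_sym.
  by rewrite eqp_mul2l // -size_poly_eq1.
exists r, eps, psi; split.
- by rewrite minnn.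
- move=> k kr; split=> //.
  + by rewrite -(monicMr _ (gmon k)) epsg smon.
  + by rewrite -(monicMr _ (gmon k)) psig.
- move=> k l /andP[kl lr].
  have gkl : g k %| g l.
    rewrite (eqp_dvdr _ (geq l)) dvdp_gcd gd andbT.
    by rewrite (dvdp_trans (gs k))// sdvd // kl lr.
  have [h hE] : exists h, g l = h * g k by exists (g l %/ g k); rewrite divpK.
  have psikE : psi k = psi l * h.
    by apply: (mulIf (g0 k)); rewrite -mulrA -hE !psig.
  split; last by rewrite psikE dvdp_mulr.
  have kdvd : eps k %| eps l * h.
    have /dvdpP[m mE] : s k %| s l by rewrite sdvd // kl lr.
    apply/dvdpP; exists m; apply: (mulIf (g0 k)).
    by rewrite -!mulrA -hE epsg mE epsg.
  move: kdvd; rewrite mulrC Gauss_dvdpr // coprimep_sym.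
  have := cop k; rewrite psikE coprimepMr => /andP[_].
  by rewrite coprimep_sym.
pose c : {poly R} := (lead_coef d0)^-1%:P.
have uc : c \is a GRing.unit.
  by rewrite poly_unitE size_polyC invr_eq0 lc0 coefC eqxx unitfE invr_eq0.
exists (c%:M *m U), V; split=> //.
  by rewrite unitmx_mul uU andbT unitmxE det_scalar unitrX.
rewrite GE NE !map_mxM map_scalar_mx mul_scalar_mx.
rewrite -!scalemxAl; set X : 'M[ratfun R]_n := map_mx _ (smith_diag _ _ _).
have d0E : d0 = (lead_coef d0)%:P * d.
  by rewrite /d mul_polyC scalerA mulfV // scale1r.
have lcF : tofrac c * tofrac (lead_coef d0)%:P = 1 :> ratfun R.
  by rewrite -tofracM -polyCM mulVf // tofrac1.
have -> : (tofrac d0)^-1 = tofrac c / tofrac d :> ratfun R.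
  rewrite {1}d0E tofracM invfM; congr (_ * _).
  by apply: (mulIf (_ : tofrac (lead_coef d0)%:P != 0));
    rewrite ?tofrac_eq0 ?polyC_eq0 // mulVf ?lcF // tofrac_eq0 polyC_eq0.
rewrite -!scalerA; congr (_ *: _); rewrite scalemxAl scalemxAr.
congr (mulmx (mulmx _ _) _).
apply/matrixP => i j; rewrite !mxE.
case: ifP => _; last by rewrite rmorph0 mulr0.
rewrite -(epsg i) -[in LHS](psig i) !tofracM invfM.
have gi : tofrac (g i) != 0 :> ratfun R by rewrite tofrac_eq0.
by rewrite rmorphM mulrACA mulVf // mulr1 mulrC.
Qed.

End SmithMcMillan.

(** * Evaluation of rational functions *)

Lemma exprV_sub (K : fieldType) (x : K) (i N : nat) : x != 0 -> (i <= N)%N ->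
  x^-1 ^+ i * x ^+ N = x ^+ (N - i).
Proof.
move=> x0 iN; rewrite -[in LHS](subnK iN) exprD mulrCA exprVn mulVf ?mulr1 //.
exact: expf_neq0.
Qed.

Section Evaluation.
Variable R : realType.
Local Notation C := R[i].
Implicit Types (f g : ratfun R) (z : C) (p q : {poly R}).

Definition peval p z : C := (map_poly (real_complex R) p).[z].

Lemma pevalD p q z : peval (p + q) z = peval p z + peval q z.
Proof. by rewrite /peval rmorphD hornerD. Qed.

Lemma pevalM p q z : peval (p * q) z = peval p z * peval q z.
Proof. by rewrite /peval rmorphM hornerM. Qed.

Lemma peval1 z : peval 1 z = 1.
Proof. by rewrite /peval rmorph1 hornerC. Qed.

Lemma peval0 z : peval 0 z = 0.
Proof. by rewrite /peval rmorph0 hornerC. Qed.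

Lemma peval_conj p z : peval p (Num.conj z) = Num.conj (peval p z).
Proof.
rewrite /peval -(horner_map Num.conj) -map_poly_comp; congr (_.[_]).
by apply/polyP => i; rewrite !coef_map /=; apply/esym/conj_Creal; rewrite complex_real.
Qed.

(** Allowing any representation as a quotient, rather than the reduced one, makes
    closure under sums and products immediate. *)
Definition regular_at f z : Prop :=
  exists p q, peval q z != 0 /\ f = tofrac p / tofrac q.

Lemma peval_neq0 q z : peval q z != 0 -> tofrac q != 0 :> ratfun R.
Proof. by rewrite tofrac_eq0; apply: contra_neq => ->; rewrite peval0. Qed.

Lemma tofrac_div_eq p q p' q' : q != 0 -> q' != 0 ->
  tofrac p / tofrac q = tofrac p' / tofrac q' :> ratfun R -> p * q' = p' * q.
Proof.
move=> q0 q'0 /eqP; rewrite eqr_div ?tofrac_eq0 //.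
by rewrite -!tofracM tofrac_eq => /eqP.
Qed.

Lemma coprime_representation f : exists p q,
  [/\ coprimep p q, q != 0, f = tofrac p / tofrac q &
      forall z, rat_eval f z = peval p z / peval q z].
Proof.
pose n := (generic_quotient.repr f).1; pose d := (generic_quotient.repr f).2.
have d0 : d != 0 by exact: denom_ratioP.
have g0 : gcdp n d != 0 by rewrite gcdp_eq0 (negPf d0) andbF.
exists (n %/ gcdp n d), (d %/ gcdp n d); split.
- by apply: coprimep_div_gcd; rewrite d0 orbT.
- by rewrite divpN0 // dvdp_leq // dvdp_gcdr.
- have G0 : tofrac (gcdp n d) != 0 :> ratfun R by rewrite tofrac_eq0.
  have nE : tofrac n = tofrac (n %/ gcdp n d) * tofrac (gcdp n d) :> ratfun R.
    by rewrite -tofracM divpK // dvdp_gcdl.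
  have dE : tofrac d = tofrac (d %/ gcdp n d) * tofrac (gcdp n d) :> ratfun R.
    by rewrite -tofracM divpK // dvdp_gcdr.
  by rewrite [LHS]frac_repr -/n -/d nE dE invfM mulrACA mulfV // mulr1.
- by move=> z; rewrite /rat_eval /n /d; case: (frac _).
Qed.

Lemma coprime_peval p q z : coprimep p q -> peval p z = 0 -> peval q z != 0.
Proof.
move=> pq pz; apply/eqP => qz.
have := pq; rewrite -(coprimep_map (real_complex R)) => /coprimep_root.
by move=> /(_ z); rewrite /root -/(peval p z) pz eqxx -/(peval q z) qz eqxx => /(_ isT).
Qed.

(** Evaluation through the reduced fraction agrees with evaluation through any
    fraction whose denominator does not vanish, because a common zero of the
    reduced pair is impossible. *)
Lemma rat_evalE f z p q : peval q z != 0 -> f = tofrac p / tofrac q ->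
  rat_eval f z = peval p z / peval q z.
Proof.
move=> qz fE; have [p' [q' [cpq q'0 fE' ->]]] := coprime_representation f.
have eqpq : p' * q = p * q'.
  apply: tofrac_div_eq => //; first by rewrite -(@tofrac_eq0 {poly R}) (peval_neq0 qz).
  exact: etrans (esym fE') fE.
have epq : peval p' z * peval q z = peval p z * peval q' z by rewrite -!pevalM eqpq.
have q'z : peval q' z != 0.
  apply/eqP => q'z; move/eqP: epq; rewrite q'z mulr0 mulf_eq0 (negPf qz) orbF => /eqP p'z.
  by have := coprime_peval cpq p'z; rewrite q'z eqxx.
by apply/eqP; rewrite eqr_div // epq.
Qed.

Lemma regular_tofrac p z : regular_at (tofrac p) z.
Proof. by exists p, 1; rewrite peval1 oner_neq0 tofrac1 divr1. Qed.

Lemma rat_eval_tofrac p z : rat_eval (tofrac p) z = peval p z.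
Proof. by rewrite (@rat_evalE _ _ p 1) ?peval1 ?divr1 ?oner_neq0 // tofrac1 divr1. Qed.

Lemma regular0 z : regular_at 0 z.
Proof. by rewrite -(@tofrac0 {poly R}); exact: regular_tofrac. Qed.

Lemma rat_eval0 z : rat_eval 0 z = 0.
Proof. by rewrite -(@tofrac0 {poly R}) rat_eval_tofrac peval0. Qed.

Lemma rat_eval1 z : rat_eval 1 z = 1.
Proof. by rewrite -(@tofrac1 {poly R}) rat_eval_tofrac peval1. Qed.

Lemma regular1 z : regular_at 1 z.
Proof. by rewrite -(@tofrac1 {poly R}); exact: regular_tofrac. Qed.

Lemma regularD_eval f g z : regular_at f z -> regular_at g z ->
  regular_at (f + g) z /\ rat_eval (f + g) z = rat_eval f z + rat_eval g z.
Proof.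
move=> [p [q [qz fE]]] [p' [q' [q'z gE]]].
have qqz : peval (q * q') z != 0 by rewrite pevalM mulf_neq0.
have sE : f + g = tofrac (p * q' + p' * q) / tofrac (q * q').
  rewrite (tofracD (p * q') (p' * q)) (tofracM p q') (tofracM p' q) (tofracM q q').
  by rewrite -(addf_div _ _ (peval_neq0 qz) (peval_neq0 q'z)) -fE -gE.
split; first by exists (p * q' + p' * q), (q * q').
by rewrite (rat_evalE qqz sE) (rat_evalE qz fE) (rat_evalE q'z gE) addf_div // pevalD !pevalM.
Qed.

Lemma regularM_eval f g z : regular_at f z -> regular_at g z ->
  regular_at (f * g) z /\ rat_eval (f * g) z = rat_eval f z * rat_eval g z.
Proof.
move=> [p [q [qz fE]]] [p' [q' [q'z gE]]].
have qqz : peval (q * q') z != 0 by rewrite pevalM mulf_neq0.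
have sE : f * g = tofrac (p * p') / tofrac (q * q').
  by rewrite (tofracM p p') (tofracM q q') -mulf_div -fE -gE.
split; first by exists (p * p'), (q * q').
by rewrite (rat_evalE qqz sE) (rat_evalE qz fE) (rat_evalE q'z gE) mulf_div // !pevalM.
Qed.

Lemma regular_sum_eval (I : Type) (r : seq I) (F : I -> ratfun R) z :
  (forall i, regular_at (F i) z) ->
  regular_at (\sum_(i <- r) F i) z /\
  rat_eval (\sum_(i <- r) F i) z = \sum_(i <- r) rat_eval (F i) z.
Proof.
move=> rF; elim: r => [|i r [IH1 IH2]].
  by rewrite !big_nil rat_eval0; split=> //; exact: regular0.
rewrite !big_cons -IH2; exact: regularD_eval.
Qed.

Definition mx_regular_at m n (A : 'M[ratfun R]_(m, n)) z : Prop :=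
  forall i j, regular_at (A i j) z.

Lemma mulmx_regular_eval m n l (A : 'M[ratfun R]_(m, n)) (B : 'M[ratfun R]_(n, l)) z :
  mx_regular_at A z -> mx_regular_at B z ->
  mx_regular_at (A *m B) z /\
  rat_evalmx (A *m B) z = rat_evalmx A z *m rat_evalmx B z.
Proof.
move=> rA rB.
have rAB i j k : regular_at (A i k * B k j) z /\
    rat_eval (A i k * B k j) z = rat_eval (A i k) z * rat_eval (B k j) z.
  exact: regularM_eval.
split.
  move=> i j; rewrite mxE.
  by have [] := @regular_sum_eval _ (index_enum 'I_n) (fun k => A i k * B k j) z (fun k => (rAB i j k).1).
apply/matrixP => i j; rewrite !mxE.
have [_ ->] := @regular_sum_eval _ (index_enum 'I_n) (fun k => A i k * B k j) z (fun k => (rAB i j k).1).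
by apply: eq_bigr => k _; rewrite !mxE (rAB i j k).2.
Qed.

Lemma rat_evalmx1 n z : rat_evalmx (1%:M : 'M[ratfun R]_n) z = 1%:M.
Proof.
apply/matrixP => i j; rewrite !mxE.
by case: (i == j); rewrite /= ?mulr1n ?mulr0n ?rat_eval1 ?rat_eval0.
Qed.

Lemma mx_regular_map m n (A : 'M[{poly R}]_(m, n)) z :
  mx_regular_at (map_mx (@tofrac _) A) z.
Proof. by move=> i j; rewrite mxE; exact: regular_tofrac. Qed.

Lemma regular_generic m n (A : 'M[ratfun R]_(m, n)) :
  exists2 d : {poly R}, d != 0 & forall z, peval d z != 0 -> mx_regular_at A z.
Proof.
have [d [N [d0 ->]]] := common_denominator A.
exists d => // z dz i j; rewrite !mxE.
by exists (N i j), d; split=> //; rewrite mulrC.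
Qed.

(** The substitution of 1/z for z, on polynomials. *)
Definition recip_poly p : ratfun R :=
  (map_poly (@tofrac {poly R} \o polyC) p).[(tofrac 'X)^-1].

(** The polynomial z^N p(1/z), for p of degree at most N. *)
Definition reverse_poly (N : nat) p : {poly R} := \sum_(i < N.+1) p`_i *: 'X^(N - i).

Let X0 : tofrac 'X != 0 :> ratfun R.
Proof. by rewrite tofrac_eq0 polyX_eq0. Qed.

Lemma recip_polyM p q : recip_poly (p * q) = recip_poly p * recip_poly q.
Proof. by rewrite /recip_poly rmorphM hornerM. Qed.

Lemma recip_polyE N p : (size p <= N.+1)%N ->
  recip_poly p = tofrac (reverse_poly N p) / tofrac 'X^N.
Proof.
move=> szp; have XN : tofrac 'X^N != 0 :> ratfun R by rewrite tofracXn expf_neq0.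
apply: (mulIf XN); rewrite divfK // /recip_poly (horner_coef_wide _ (n := N.+1)).
  rewrite mulr_suml raddf_sum; apply: eq_bigr => i _.
  rewrite coef_map /= -mul_polyC tofracM !tofracXn -mulrA; congr (_ * _).
  by apply: exprV_sub; [exact: X0 | rewrite -ltnS].
by rewrite (leq_trans (size_poly _ _)).
Qed.

Lemma peval_reverse N p z : z != 0 -> (size p <= N.+1)%N ->
  peval (reverse_poly N p) z = z ^+ N * peval p z^-1.
Proof.
move=> z0 szp; rewrite /peval raddf_sum horner_sum.
rewrite (horner_coef_wide _ (n := N.+1)); last first.
  by rewrite (leq_trans (size_poly _ _)).
rewrite mulr_sumr; apply: eq_bigr => i _.
rewrite /= map_polyZ map_polyXn hornerZ hornerXn coef_map mulrCA; congr (_ * _).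
by rewrite mulrC exprV_sub // -ltnS.
Qed.

Lemma recip_poly_neq0 p : p != 0 -> recip_poly p != 0.
Proof.
move=> p0; have szp : (size p <= (size p).-1.+1)%N by exact: leqSpred.
rewrite (recip_polyE szp); apply: mulf_neq0; last first.
  by rewrite invr_eq0 tofrac_eq0 monic_neq0 ?monicXn.
rewrite tofrac_eq0.
apply/eqP => /(congr1 (fun q : {poly R} => q`_0)).
rewrite coef0 coef_sum (bigD1 ord_max) //= subnn expr0 coefZ coefC eqxx mulr1 big1 ?addr0.
  by move/eqP; rewrite -lead_coefE lead_coef_eq0 (negPf p0).
move=> i im; rewrite coefZ coefXn.
have iN : (i < (size p).-1)%N.
  by rewrite ltn_neqAle -ltnS ltn_ord andbT; apply: contra im => /eqP im; apply/eqP/val_inj.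
by rewrite eq_sym subn_eq0 leqNgt iN mulr0.
Qed.

Lemma rat_recipE p q : q != 0 ->
  rat_recip (tofrac p / tofrac q) = recip_poly p / recip_poly q.
Proof.
move=> q0; set f := _ / _; have -> : rat_recip f =
    recip_poly (generic_quotient.repr f).1 / recip_poly (generic_quotient.repr f).2.
  by rewrite /rat_recip; case: (frac _).
set p' := _.1; set q' := _.2; have q'0 : q' != 0 by exact: denom_ratioP.
have eqpq : p' * q = p * q'.
  by apply: tofrac_div_eq => //; exact: esym (frac_repr f).
by apply/eqP; rewrite eqr_div ?recip_poly_neq0 // -!recip_polyM eqpq.
Qed.

(** Multiplying numerator and denominator by a common power of z turns
    p(1/z) / q(1/z) into a quotient of polynomials. *)
Lemma rat_recip_eval f z : z != 0 -> regular_at f z^-1 ->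
  regular_at (rat_recip f) z /\ rat_eval (rat_recip f) z = rat_eval f z^-1.
Proof.
move=> z0 [p [q [qz fE]]]; have q0 : q != 0 by rewrite -(@tofrac_eq0 {poly R}) (peval_neq0 qz).
pose N := maxn (size p) (size q).
have szp : (size p <= N.+1)%N by rewrite ltnW // ltnS leq_maxl.
have szq : (size q <= N.+1)%N by rewrite ltnW // ltnS leq_maxr.
have XN : tofrac 'X^N != 0 :> ratfun R by rewrite tofracXn expf_neq0.
have rfE : rat_recip f = tofrac (reverse_poly N p) / tofrac (reverse_poly N q).
  by rewrite fE rat_recipE // (recip_polyE szp) (recip_polyE szq) invfM invrK mulrACA mulVf ?mulr1.
have rz : peval (reverse_poly N q) z != 0.
  by rewrite peval_reverse // mulf_neq0 ?expf_neq0.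
split; first by exists (reverse_poly N p), (reverse_poly N q).
rewrite (rat_evalE rz rfE) (rat_evalE qz fE) !peval_reverse //.
by rewrite invfM mulrACA mulfV ?mul1r ?expf_neq0.
Qed.

End Evaluation.

(** * Poles and zeros as failures of regularity *)

Section PolesZeros.
Variable R : realType.
Local Notation C := R[i].

Lemma coprime_ratio_regular (eps psi : {poly R}) (z : C) :
  coprimep eps psi -> psi != 0 ->
  regular_at (tofrac eps / tofrac psi : ratfun R) z -> peval psi z != 0.
Proof.
move=> cop psi0 [p [q [qz eE]]]; apply/eqP => psiz.
have eq1 : eps * q = p * psi.
  by apply: tofrac_div_eq eE => //; rewrite -(@tofrac_eq0 {poly R}) (peval_neq0 qz).
have /eqP : peval eps z * peval q z = 0 by rewrite -pevalM eq1 pevalM psiz mulr0.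
rewrite mulf_eq0 (negPf qz) orbF => /eqP epsz.
by have := coprime_peval cop epsz; rewrite psiz eqxx.
Qed.

(** The middle factor of a Smith-McMillan form of full rank. *)
Definition ratio_diag n (a b : nat -> {poly R}) : 'M[ratfun R]_n :=
  \matrix_(i, j) if i == j :> nat then tofrac (a i) / tofrac (b i) else 0.

Lemma ratio_diagK n (a b : nat -> {poly R}) :
  (forall k, (k < n)%N -> a k != 0) -> (forall k, (k < n)%N -> b k != 0) ->
  ratio_diag n a b *m ratio_diag n b a = 1%:M.
Proof.
move=> a0 b0; apply/matrixP => i j; rewrite !mxE (bigD1 i) //= big1 ?addr0.
  rewrite !mxE eqxx; have [<-|ij] := eqVneq i j.
    by rewrite ?eqxx mulrA divfK ?mulfV ?tofrac_eq0 ?a0 ?b0.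
  by rewrite (negbTE ij : (i == j :> nat) = false) mulr0.
by move=> k; rewrite eq_sym !mxE => ik; rewrite (negbTE ik : (i == k :> nat) = false) mul0r.
Qed.

(** A rank below n would leave a zero row in the diagonal factor, so an invertible
    matrix has n invariant fractions, and inverting them gives its inverse. *)
Lemma smith_mcmillan_full n (G : 'M[ratfun R]_n) r eps psi :
  G \in unitmx -> smith_mcmillan G r eps psi ->
  exists U V : 'M[{poly R}]_n,
    [/\ U \in unitmx, V \in unitmx, r = n,
        G = map_mx (@tofrac _) U *m ratio_diag n eps psi *m map_mx (@tofrac _) V &
        invmx G = map_mx (@tofrac _) (invmx V) *m ratio_diag n psi eps *m
                  map_mx (@tofrac _) (invmx U)].
Proof.
move=> uG [rn mon _ [U [V [uU uV GE]]]]; exists U, V.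
have rE : r = n.
  apply/eqP; rewrite eqn_leq; move: rn; rewrite minnn => -> /=.
  rewrite leqNgt; apply/negP => rn.
  move: uG; rewrite GE !unitmx_mul => /andP[/andP[_]].
  rewrite unitmxE => uD _; move: uD; set D := (X in \det X).
  rewrite (expand_det_row D (Ordinal rn)) big1 ?unitr0 // => j _.
  by rewrite mxE /= ltnn andbF mul0r.
have GE' : G = map_mx (@tofrac _) U *m ratio_diag n eps psi *m map_mx (@tofrac _) V.
  rewrite GE rE; congr (mulmx (mulmx _ _) _).
  by apply/matrixP => i j; rewrite !mxE ltn_ord andbT.
split=> //.
have eps0 k : (k < n)%N -> eps k != 0 by rewrite -rE => /mon[/monic_neq0].
have psi0 k : (k < n)%N -> psi k != 0 by rewrite -rE => /mon[_ /monic_neq0].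
have UU : map_mx (@tofrac {poly R}) U *m map_mx (@tofrac _) (invmx U) = 1%:M.
  by rewrite -map_mxM mulmxV // map_mx1.
have VV : map_mx (@tofrac {poly R}) V *m map_mx (@tofrac _) (invmx V) = 1%:M.
  by rewrite -map_mxM mulmxV // map_mx1.
apply: (can_inj (mulKmx uG)); rewrite mulmxV // [in RHS]GE' !mulmxA.
rewrite -[_ *m map_mx _ V *m _]mulmxA VV mulmx1.
by rewrite -[_ *m ratio_diag n eps psi *m _]mulmxA ratio_diagK // mulmx1 UU.
Qed.

Lemma regular_pole n (G : 'M[ratfun R]_n) (z : C) : G \in unitmx ->
  mx_regular_at G z -> ~ is_pole G z.
Proof.
move=> uG rG [r [eps [psi [sm [k kr]]]]]; rewrite /root -/(peval _ _) => /eqP psiz.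
have [U [V [uU uV rE GE _]]] := smith_mcmillan_full uG sm.
have [_ mon _ _] := sm; have [_ mpsi cop] := mon k kr.
have DE : ratio_diag n eps psi =
    map_mx (@tofrac _) (invmx U) *m G *m map_mx (@tofrac _) (invmx V).
  rewrite GE !mulmxA -map_mxM mulVmx // map_mx1 mul1mx -mulmxA -map_mxM.
  by rewrite mulmxV // map_mx1 mulmx1.
have rD : mx_regular_at (ratio_diag n eps psi) z.
  rewrite DE; apply: (mulmx_regular_eval _ (mx_regular_map _ _)).1.
  exact: (mulmx_regular_eval (mx_regular_map _ _) rG).1.
rewrite rE in kr; have := rD (Ordinal kr) (Ordinal kr); rewrite mxE eqxx /=.
by move/(coprime_ratio_regular cop (monic_neq0 mpsi)); rewrite psiz eqxx.
Qed.

Lemma regular_zero n (G : 'M[ratfun R]_n) (z : C) : G \in unitmx ->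
  mx_regular_at (invmx G) z -> ~ is_zero G z.
Proof.
move=> uG rG [r [eps [psi [sm [k kr]]]]]; rewrite /root -/(peval _ _) => /eqP epsz.
have [U [V [uU uV rE _ GE]]] := smith_mcmillan_full uG sm.
have [_ mon _ _] := sm; have [meps _ cop] := mon k kr.
have DE : ratio_diag n psi eps =
    map_mx (@tofrac _) V *m invmx G *m map_mx (@tofrac _) U.
  rewrite GE !mulmxA -map_mxM mulmxV // map_mx1 mul1mx -mulmxA -map_mxM.
  by rewrite mulVmx // map_mx1 mulmx1.
have rD : mx_regular_at (ratio_diag n psi eps) z.
  rewrite DE; apply: (mulmx_regular_eval _ (mx_regular_map _ _)).1.
  exact: (mulmx_regular_eval (mx_regular_map _ _) rG).1.
rewrite rE in kr; have := rD (Ordinal kr) (Ordinal kr); rewrite mxE eqxx /=.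
rewrite coprimep_sym in cop.
by move/(coprime_ratio_regular cop (monic_neq0 meps)); rewrite epsz eqxx.
Qed.

(** One form suffices: the denominators psi_k are the only ones in G, and the
    numerators eps_k the only ones in its inverse. *)
Lemma no_pole_zero_regular n (G : 'M[ratfun R]_n) (z : C) : G \in unitmx ->
  ~ is_zero G z -> ~ is_pole G z ->
  mx_regular_at G z /\ mx_regular_at (invmx G) z.
Proof.
move=> uG nz np; have [r [eps [psi sm]]] := smith_mcmillan_exists G.
have [U [V [uU uV rE GE GiE]]] := smith_mcmillan_full uG sm.
have rdiag (a b : nat -> {poly R}) :
    (forall k, (k < n)%N -> peval (b k) z != 0) -> mx_regular_at (ratio_diag n a b) z.
  move=> bz i j; rewrite mxE; case: ifP => _; last exact: regular0.
  by exists (a i), (b i); rewrite bz.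
split.
  rewrite GE; apply: (mulmx_regular_eval _ (mx_regular_map _ _)).1.
  apply: (mulmx_regular_eval (mx_regular_map _ _) _).1; apply: rdiag => k kn.
  apply/negP => psiz; apply: np; exists r, eps, psi; split=> //.
  by exists k; rewrite ?rE.
rewrite GiE; apply: (mulmx_regular_eval _ (mx_regular_map _ _)).1.
apply: (mulmx_regular_eval (mx_regular_map _ _) _).1; apply: rdiag => k kn.
apply/negP => epsz; apply: nz; exists r, eps, psi; split=> //.
by exists k; rewrite ?rE.
Qed.

End PolesZeros.

(** * Operator norms and singular values *)

Section OperatorBound.
Variable R : realType.
Local Notation C := R[i].
Local Open Scope sesquilinear_scope.

(** The squared Euclidean norm, kept complex-valued so that it can be rewritten
    as a matrix product. *)
Definition nsq n (v : 'cV[C]_n) : C := (v ^t* *m v) 0 0.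

Lemma nsqE n (v : 'cV[C]_n) : nsq v = \sum_i `|v i 0| ^+ 2.
Proof. by rewrite /nsq mxE; apply: eq_bigr => i _; rewrite !mxE mulrC normCK. Qed.

Lemma nsq_ge0 n (v : 'cV[C]_n) : 0 <= nsq v.
Proof. by rewrite nsqE sumr_ge0 // => i _; rewrite exprn_ge0. Qed.

Lemma nsq_gt0 n (v : 'cV[C]_n) : v != 0 -> 0 < nsq v.
Proof.
move=> /matrix0Pn[i [j]]; rewrite ord1 => vi0; rewrite nsqE (bigD1 i) //=.
rewrite ltr_wpDr ?exprn_gt0 ?normr_gt0 // sumr_ge0 // => k _; exact: exprn_ge0.
Qed.

Lemma adj_mul m n p (A : 'M[C]_(m, n)) (B : 'M[C]_(n, p)) :
  (A *m B) ^t* = B ^t* *m A ^t*.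
Proof. by rewrite trmx_mul map_mxM. Qed.

Lemma nsq_adj n (v : 'rV[C]_n) : nsq (v ^t*) = (v *m v ^t*) 0 0.
Proof. by rewrite /nsq trmxCK. Qed.

Lemma nsq_mul m n (A : 'M[C]_(m, n)) (w : 'cV[C]_n) :
  nsq (A *m w) = (w ^t* *m (A ^t* *m A) *m w) 0 0.
Proof. by rewrite /nsq adj_mul !mulmxA. Qed.

Lemma cauchy_schwarz n (u v : 'cV[C]_n) :
  `|(u ^t* *m v) 0 0| ^+ 2 <= nsq u * nsq v.
Proof.
have : `|dotmx (u ^t*) (v ^t*)| ^+ 2 <= dotmx (u ^t*) (u ^t*) * dotmx (v ^t*) (v ^t*).
  exact: (CauchySchwarz _ _ _).1.
by rewrite !dotmxE !trmxCK.
Qed.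

(** The squared operator norm of A is at most l.  The bilinear form is chosen
    because, for a rational matrix G, each u^* G(z) w is a scalar rational function of
    z, to which the maximum principle applies; it is also symmetric under taking
    adjoints. *)
Definition opbound m n (A : 'M[C]_(m, n)) (l : R) : Prop :=
  forall (u : 'cV[C]_m) (w : 'cV[C]_n),
    `|(u ^t* *m A *m w) 0 0| ^+ 2 <= l%:C * (nsq u * nsq w).

Lemma opboundP m n (A : 'M[C]_(m, n)) (l : R) : 0 <= l ->
  opbound A l <-> forall w, nsq (A *m w) <= l%:C * nsq w.
Proof.
move=> l0; have l0' : 0 <= l%:C :> C by rewrite lecR.
split=> [bA w|bA u w]; last first.
  rewrite -mulmxA (le_trans (cauchy_schwarz _ _)) // mulrCA.
  by rewrite ler_wpM2l ?nsq_ge0.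
have [Aw0|Aw0] := eqVneq (A *m w) 0.
  by rewrite Aw0 /nsq mulmx0 [X in X <= _]mxE mulr_ge0 ?nsq_ge0.
have := bA (A *m w) w; rewrite -mulmxA -/(nsq _) ger0_norm ?nsq_ge0 // expr2.
by rewrite [X in _ <= X]mulrCA ler_pM2l // nsq_gt0.
Qed.

Lemma opbound_adj m n (A : 'M[C]_(m, n)) (l : R) :
  opbound A l -> opbound (A ^t*) l.
Proof.
move=> bA u w; have := bA w u; rewrite [nsq w * _]mulrC; congr (_ <= _).
rewrite -norm_conjC; congr (`|_| ^+ 2).
have -> : u ^t* *m A ^t* *m w = (w ^t* *m A *m u) ^t*.
  by rewrite !adj_mul trmxCK mulmxA.
by rewrite [in RHS]mxE [in RHS]mxE.
Qed.

Lemma opbound_frobenius m n (A : 'M[C]_(m, n)) (l : R) :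
  \sum_i nsq ((row i A) ^t*) <= l%:C -> opbound A l.
Proof.
move=> Fl; have F0 : 0 <= \sum_i nsq ((row i A) ^t*).
  by rewrite sumr_ge0 // => i _; exact: nsq_ge0.
have l0 : 0 <= l by rewrite -lecR (le_trans F0 Fl).
apply/opboundP => // w.
apply: (@le_trans _ _ ((\sum_i nsq ((row i A) ^t*)) * nsq w)); last first.
  by rewrite ler_wpM2r ?nsq_ge0.
rewrite nsqE mulr_suml ler_sum // => i _.
have -> : (A *m w) i 0 = ((row i A) ^t* ^t* *m w) 0 0.
  by rewrite trmxCK -row_mul [RHS]mxE.
exact: cauchy_schwarz.
Qed.

Lemma opbound_exists m n (A : 'M[C]_(m, n)) : exists2 l, 0 <= l & opbound A l.
Proof.
pose F : C := \sum_i nsq ((row i A) ^t*).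
have F0 : 0 <= F by rewrite sumr_ge0 // => i _; exact: nsq_ge0.
have FE : F = (complex.Re F)%:C by rewrite RRe_real // ger0_real.
exists (complex.Re F); first by rewrite -lecR -FE.
by apply: opbound_frobenius; rewrite -FE.
Qed.

Lemma opbound_entry m n (A : 'M[C]_(m, n)) (l : R) i j :
  opbound A l -> `|A i j| ^+ 2 <= l%:C.
Proof.
move=> /(_ (delta_mx i 0) (delta_mx j 0)).
have nd k (h : 'I_k) : nsq (delta_mx h 0) = 1.
  rewrite nsqE (bigD1 h) //= big1 ?addr0 ?mxE ?eqxx ?normr1 ?expr1n // => t th.
  by rewrite mxE (negPf th) normr0 expr0n.
rewrite !nd !mulr1; congr (`|_| ^+ 2 <= _).
have -> : (delta_mx i 0 : 'cV[C]_m) ^t* = delta_mx 0 i.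
  by rewrite trmx_delta map_delta_mx.
by rewrite -rowE -colE !mxE.
Qed.

Lemma singular_value_le m n (A : 'M[C]_(m, n)) (l s : R) : 0 <= l ->
  opbound A l -> singular_values A s -> s ^+ 2 <= l.
Proof.
move=> l0 /opboundP-/(_ l0) bA [s0 /eigenvalueP[v vE v0]].
have := bA (v ^t*); rewrite nsq_mul trmxCK vE -scalemxAl mxE -nsq_adj.
rewrite ler_pM2r ?lecR // nsq_gt0 //.
by apply: contra_neq v0 => v0; rewrite -[v]trmxCK v0 trmx0 map_mx0.
Qed.

Lemma sigma_max_ge0 m n (A : 'M[C]_(m, n)) : 0 <= sigma_max A.
Proof.
have [hs|nhs] := pselect (has_sup (singular_values A)); last by rewrite /sigma_max sup_out.
have [[s sA] hub] := hs; apply: (@le_trans _ _ s); first by have [] := sA.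
exact: ub_le_sup.
Qed.

Lemma sigma_max_le m n (A : 'M[C]_(m, n)) (l : R) : 0 <= l ->
  opbound A l -> sigma_max A ^+ 2 <= l.
Proof.
move=> l0 bA; have [ne|e] := pselect (singular_values A !=set0); last first.
  by rewrite /sigma_max sup_out ?expr0n // => -[].
rewrite -(sqr_sqrtr l0) ler_sqr ?nnegrE ?sqrtr_ge0 ?sigma_max_ge0 //.
apply: ge_sup => // s sA; rewrite -ler_sqr ?nnegrE ?sqrtr_ge0 //; last by have [] := sA.
by rewrite sqr_sqrtr // (singular_value_le l0 bA).
Qed.

(** The eigenvalues of the Hermitian matrix A^* A are squares of singular
    values, and in a unitary eigenbasis they bound the quadratic form. *)
Lemma opbound_sigma_max m n (A : 'M[C]_(m, n)) : opbound A (sigma_max A ^+ 2).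
Proof.
have [l0 l0_ge0 bA] := opbound_exists A.
pose B := A ^t* *m A.
have nB : B \is normalmx.
  by apply/normalmxP; rewrite /B adj_mul trmxCK.
pose P := spectralmx B; pose sp := spectral_diag B.
have BE : B = invmx P *m diag_mx sp *m P by exact/orthomx_spectralP.
have uP : P \is unitarymx by exact: spectral_unitarymx.
have vP : invmx P = P ^t* by exact: invmx_unitary.
have rowB i : row i P *m B = sp 0 i *: row i P.
  rewrite BE -row_mul !mulmxA mulmxV ?spectral_unit // mul1mx.
  by rewrite mul_diag_mx; apply/rowP => j; rewrite !mxE.
have row0 i : row i P != 0.
  apply/eqP => ri; have /row_unitarymxP/(_ i i) := uP.
  by rewrite ri dotmxE mul0mx mxE eqxx => /eqP; rewrite eq_sym oner_eq0.
have sp_le i : sp 0 i <= (sigma_max A ^+ 2)%:C.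
  pose w := (row i P) ^t*.
  have w0 : 0 < nsq w.
    apply: nsq_gt0; apply: contra_neq (row0 i) => w0.
    by rewrite -[row i P]trmxCK -/w w0 trmx0 map_mx0.
  have Aw : nsq (A *m w) = sp 0 i * nsq w.
    by rewrite nsq_mul trmxCK rowB -scalemxAl mxE -nsq_adj.
  have sp0 : 0 <= sp 0 i by rewrite -(pmulr_lge0 _ w0) -Aw nsq_ge0.
  have spE : sp 0 i = (Num.sqrt (complex.Re (sp 0 i)) ^+ 2)%:C.
    rewrite sqr_sqrtr; first by rewrite RRe_real // ger0_real.
    by rewrite -lecR RRe_real // ger0_real.
  have sA : singular_values A (Num.sqrt (complex.Re (sp 0 i))).
    split; first exact: sqrtr_ge0.
    by apply/eigenvalueP; exists (row i P) => //; rewrite -spE.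
  rewrite spE lecR ler_sqr ?nnegrE ?sqrtr_ge0 ?sigma_max_ge0 //.
  apply: ub_le_sup => //; exists (Num.sqrt l0) => s sAs.
  rewrite -ler_sqr ?nnegrE ?sqrtr_ge0 //; last by have [] := sAs.
  by rewrite sqr_sqrtr // (singular_value_le l0_ge0 bA).
apply/opboundP; first exact: sqr_ge0.
move=> w; have wE : nsq w = nsq (P *m w).
  by rewrite nsq_mul -vP mulVmx ?spectral_unit // mulmx1.
rewrite nsq_mul -/B BE vP wE.
have -> : w ^t* *m (P ^t* *m diag_mx sp *m P) *m w =
          (P *m w) ^t* *m (diag_mx sp *m (P *m w)).
  by rewrite adj_mul !mulmxA.
rewrite mul_diag_mx mxE nsqE mulr_sumr ler_sum // => i _.
rewrite !mxE -/((P *m w) i 0) mulrCA -normCKC ler_wpM2r ?exprn_ge0 //.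
Qed.

End OperatorBound.

(** * Continuity of rational functions *)

Section ComplexTopology.
Variable R : realType.
Local Notation C := R[i].

Definition modulus (z : C) : R := complex.Re `|z|.

Lemma modulusE (z : C) : `|z| = (modulus z)%:C.
Proof. by rewrite /modulus RRe_real ?normr_real. Qed.

Lemma modulus_ge0 (z : C) : 0 <= modulus z.
Proof. by rewrite -lecR -modulusE normr_ge0. Qed.

Lemma normr_realC (x : R) : `|x%:C| = `|x|%:C :> C.
Proof. by rewrite normc_def /= expr0n addr0 sqrtr_sqr. Qed.

Lemma posC_real (e : C) : 0 < e -> exists2 r : R, 0 < r & e = r%:C.
Proof.
move=> e0; have eE : e = (complex.Re e)%:C by rewrite RRe_real // gtr0_real.
by exists (complex.Re e) => //; rewrite -ltcR -eE.
Qed.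

Lemma continuous_Re : continuous (@complex.Re R : C^o -> R).
Proof.
move=> z; apply/(@cvgrPdist_lt _ _ _ (nbhs (z : C^o)) _) => e e0.
have e0' : 0 < e%:C :> C by rewrite ltcR.
near=> w; rewrite -ltcR.
have zw : `|z - w| < e%:C.
  by near: w; exact: (@cvgr_dist_lt _ _ _ (nbhs (z : C^o)) _ (id : C^o -> C^o) z (fun A => id) _ e0').
apply: le_lt_trans zw.
by rewrite (le_trans _ (normc_ge_Re _)) // raddfB.
Unshelve. all: by end_near. Qed.

Lemma normc_ge_Im (x : C) : `|complex.Im x|%:C <= `|x|.
Proof.
case: x => a b; have := normc_ge_Re (b +i* a).
by rewrite !normc_def /= [X in Num.sqrt X]addrC.
Qed.

Lemma continuous_Im : continuous (@complex.Im R : C^o -> R).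
Proof.
move=> z; apply/(@cvgrPdist_lt _ _ _ (nbhs (z : C^o)) _) => e e0.
have e0' : 0 < e%:C :> C by rewrite ltcR.
near=> w; rewrite -ltcR.
have zw : `|z - w| < e%:C.
  by near: w; exact: (@cvgr_dist_lt _ _ _ (nbhs (z : C^o)) _ (id : C^o -> C^o) z (fun A => id) _ e0').
apply: le_lt_trans zw.
by rewrite (le_trans _ (normc_ge_Im _)) // raddfB.
Unshelve. all: by end_near. Qed.

Lemma continuous_modulus : continuous (modulus : C^o -> R).
Proof.
move=> z; apply: (continuous_comp (f := (fun z : C^o => `|z| : C^o))).
  exact: norm_continuous.
exact: continuous_Re.
Qed.

Lemma continuous_complex (T : topologicalType) (f g : T -> R) (x : T) :
  {for x, continuous f} -> {for x, continuous g} ->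
  {for x, continuous (fun t => (f t +i* g t) : C^o)}.
Proof.
move=> cf cg; apply/(@cvgrPdist_lt _ _ _ (nbhs x) _) => e /posC_real[r r0 ->].
have r2 : 0 < r / 2 by rewrite divr_gt0.
have /cvgrPdist_lt/(_ _ r2) cf' := cf; have /cvgrPdist_lt/(_ _ r2) cg' := cg.
near=> t.
have -> : (f x +i* g x) - (f t +i* g t) = (f x - f t)%:C + 'i * (g x - g t)%:C.
  by rewrite [LHS]complexE.
rewrite (le_lt_trans (ler_normD _ _)) // normrM normCi mul1r !normr_realC.
rewrite -rmorphD ltcR [ltRHS]splitr ltrD //; near: t.
  exact: cf'.
exact: cg'.
Unshelve. all: by end_near. Qed.

Lemma continuous_hornerC (P : {poly C}) : continuous (fun w : C^o => P.[w] : C^o).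
Proof.
elim/poly_ind: P => [|P c IH] w.
  have -> : (fun w : C^o => (0 : {poly C}).[w] : C^o) = cst 0.
    by apply/funext => x; rewrite horner0.
  exact: cst_continuous.
have -> : (fun w : C^o => (P * 'X + c%:P).[w] : C^o) =
    ((fun w : C^o => P.[w] : C^o) \* (id : C^o -> C^o)) + (cst c : C^o -> C^o).
  by apply/funext => x; rewrite hornerMXaddC.
apply: continuousD; last exact: cst_continuous.
by apply: continuousM; [exact: IH|exact: (fun A => id)].
Qed.

Lemma continuous_peval (p : {poly R}) : continuous (peval p : C^o -> C^o).
Proof. exact: continuous_hornerC. Qed.

Lemma regular_continuous (f : ratfun R) (z : C) : regular_at f z ->
  {for z, continuous (rat_eval f : C^o -> C^o)}.
Proof.
move=> [p [q [qz fE]]].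
have cq : {for z, continuous (peval q : C^o -> C^o)} by exact: continuous_peval.
rewrite /prop_for /continuous_at (rat_evalE qz fE).
have cpq : {for z, continuous (fun w : C^o => peval p w / peval q w : C^o)}.
  by apply: continuousM; [exact: continuous_peval|exact: continuousV].
apply: cvg_trans cpq; apply: (@near_eq_cvg _ _ (nbhs (z : C^o)) _).
near=> w; rewrite (rat_evalE _ fE) //.
rewrite -normr_gt0; near: w.
by apply: (cvgr_norm_gt _ cq); rewrite normr_gt0.
Unshelve. all: by end_near. Qed.

End ComplexTopology.

(** * Bounded rational functions have no poles *)

Section Accumulation.
Variable R : realType.
Local Notation C := R[i].

(** Every neighbourhood of z0 contains points of S outside any given finite set of
    exceptional points, the zeros of a polynomial. *)
Definition generically_near (S : set C) (z0 : C) : Prop :=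
  forall (e : R) (d : {poly R}), 0 < e -> d != 0 ->
    exists z, [/\ S z, modulus (z - z0) < e & peval d z != 0].

Lemma peval_roots_bound (d : {poly R}) (s : seq C) : d != 0 -> uniq s ->
  all (fun z => peval d z == 0) s -> (size s < size d)%N.
Proof.
move=> d0 us ds; rewrite -(size_map_poly (real_complex R) d).
by apply: max_poly_roots => //; rewrite map_poly_eq0.
Qed.

(** A polynomial vanishes at finitely many terms only of an injective family that
    tends to z0. *)
Lemma generically_near_seq (S : set C) (z0 : C) (u : R -> C) (c : R) :
  {in [pred s | 0 < s] &, injective u} ->
  (forall s, 0 < s -> S (u s)) ->
  (forall s, 0 < s -> modulus (u s - z0) <= c * s) -> generically_near S z0.
Proof.
move=> ui uS uz e d e0 d0; apply: contrapT => nex.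
(* c1 is positive even if c is not; the shift in k.+2 makes the final inequality
   strict. *)
pose c1 := `|c| + 1; have c10 : 0 < c1 by rewrite ltr_wpDl.
pose t (k : nat) : R := e / c1 / k.+2%:R.
have t0 k : 0 < t k by rewrite !divr_gt0.
have ti : injective t.
  have ec : e / c1 != 0 by rewrite gt_eqF // divr_gt0.
  by move=> k l /(mulfI ec)/invr_inj/eqP; rewrite eqr_nat => /eqP[].
pose s := [seq u (t k) | k <- iota 0 (size d)].
suff : (size s < size d)%N by rewrite size_map size_iota ltnn.
apply: peval_roots_bound => //.
  rewrite map_inj_uniq ?iota_uniq // => k l e1.
  by apply/ti/ui; rewrite ?inE.
apply/allP => z /mapP[k _ ->]; apply/negPn/negP => dz.
apply: nex; exists (u (t k)); split=> //; first exact: uS.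
rewrite (le_lt_trans (uz _ (t0 k))) // (@le_lt_trans _ _ (c1 * t k)) //.
  by rewrite ler_wpM2r ?(ltW (t0 k)) // (le_trans (ler_norm c)) // lerDl.
rewrite /t mulrA [c1 * _]mulrC divfK ?gt_eqF //.
by rewrite ltr_pdivrMr ?ltr0n // ltr_pMr // ltr1n.
Qed.

Lemma generically_near_le (S : set C) (z0 : C) (d : {poly R}) (F : C^o -> R) :
  generically_near S z0 -> d != 0 -> {for (z0 : C^o), continuous F} ->
  (forall z, S z -> peval d z != 0 -> F z <= 0) -> F z0 <= 0.
Proof.
move=> Sz0 d0 cF FS; rewrite leNgt; apply/negP => F0.
have : \forall z \near (z0 : C^o), F z > 0 by exact: (cvgr_gt _ cF).
move=> /nbhs_ballP[e /posC_real[r r0 ->]] H.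
have [z [Sz zr dz]] := Sz0 r d r0 d0.
have := FS z Sz dz; rewrite leNgt => /negP; apply; apply: H.
by rewrite -ball_normE /= distrC modulusE ltcR.
Qed.

Lemma continuous_modulus_comp (f : C -> C) (z : C) :
  {for z, continuous (f : C^o -> C^o)} -> {for (z : C^o), continuous (fun w : C^o => modulus (f w))}.
Proof. by move=> cf; apply: (@continuous_comp C^o C^o R f (@modulus R) z cf); exact: continuous_modulus. Qed.

(** From |f| <= B one gets |p| <= B |q| for the reduced fraction p / q, and this
    passes to the limit: if q vanished at z0 then so would p. *)
Lemma bounded_regular (S : set C) (z0 : C) (d : {poly R}) (f : ratfun R) (B : R) :
  generically_near S z0 -> d != 0 ->
  (forall z, S z -> peval d z != 0 -> modulus (rat_eval f z) <= B) ->
  regular_at f z0.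
Proof.
move=> Sz0 d0 fB; have [p [q [cpq q0 fE fz]]] := coprime_representation f.
exists p, q; split=> //; apply/eqP => qz0.
have dq0 : d * q != 0 by rewrite mulf_neq0.
pose F (z : C^o) := modulus (peval p z) - B * modulus (peval q z).
have cF : {for (z0 : C^o), continuous F}.
  apply: continuousB; first exact: (continuous_modulus_comp (@continuous_peval _ p z0)).
  apply: continuousM; first exact: cst_continuous.
  exact: (continuous_modulus_comp (@continuous_peval _ q z0)).
have : F z0 <= 0.
  apply: (generically_near_le Sz0 dq0 cF) => z Sz.
  rewrite pevalM mulf_eq0 negb_or => /andP[dz qz].
  have := fB z Sz dz; rewrite fz /F subr_le0 -lecR -modulusE normrM normfV.
  rewrite !modulusE -fmorphV -rmorphM lecR ler_pdivrMr //.
  by rewrite -ltcR -modulusE normr_gt0.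
rewrite /F qz0 {2}/modulus normr0 mulr0 subr0 -lecR -modulusE normr_le0 => /eqP pz0.
by have := coprime_peval cpq pz0; rewrite qz0 eqxx.
Qed.

Lemma generically_near_setT (z0 : C) : generically_near setT z0.
Proof.
apply: (@generically_near_seq _ z0 (fun s => z0 + s%:C) 1) => //.
  by move=> s t _ _ /addrI/complexI.
by move=> s s0; rewrite addrAC subrr add0r mul1r -lecR -modulusE normr_realC gtr0_norm.
Qed.

Lemma generically_near_outside (z0 : C) : `|z0| = 1 ->
  generically_near [set z | 1 < `|z|] z0.
Proof.
move=> z01; have z00 : z0 != 0 by rewrite -normr_gt0 z01.
apply: (@generically_near_seq _ z0 (fun s => z0 * (1 + s%:C)) 1).
- by move=> s t _ _ /(mulfI z00)/addrI/complexI.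
- move=> s s0 /=; rewrite normrM z01 mul1r -(rmorph1 (real_complex R)) -rmorphD.
  by rewrite normr_realC ltcR ger0_norm ?ltrDl // addr_ge0 // ltW.
- move=> s s0; rewrite mulrDr mulr1 addrAC subrr add0r mul1r -lecR -modulusE.
  by rewrite normrM z01 mul1r normr_realC gtr0_norm.
Qed.

(** The points z0 (1 + is) / (1 - is) lie on the circle and tend to z0 with s. *)
Lemma generically_near_circle (z0 : C) : `|z0| = 1 ->
  generically_near (@unit_circle R) z0.
Proof.
move=> z01; have z00 : z0 != 0 by rewrite -normr_gt0 z01.
have nz (s : R) : 1 - 'i * s%:C != 0.
  apply/eqP => /(congr1 (@complex.Re R)) /=; rewrite !(mul0r, mulr0, subr0) => /eqP.
  by rewrite oner_eq0.
have ni (s : R) : 0 < s -> 1 <= `|1 - 'i * s%:C|.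
  move=> s0; rewrite (le_trans _ (normc_ge_Re _)) //=.
  by rewrite !(mul0r, mulr0, subr0) normr1.
apply: (@generically_near_seq _ z0 (fun s => z0 * ((1 + 'i * s%:C) / (1 - 'i * s%:C))) 2).
- move=> s t _ _ /(mulfI z00)/eqP; rewrite eqr_div // => /eqP e.
  have : 2 * ('i * s%:C) = 2 * ('i * t%:C).
    apply/eqP; rewrite -subr_eq0; apply/eqP.
    rewrite (_ : _ - _ = (1 + 'i * s%:C) * (1 - 'i * t%:C) -
      (1 + 'i * t%:C) * (1 - 'i * s%:C)); last by ring.
    by rewrite e subrr.
  have two0 : 2 != 0 :> C by rewrite pnatr_eq0.
  have i0 : 'i != 0 :> C by rewrite -normr_gt0 normCi ltr01.
  by move=> /(mulfI two0)/(mulfI i0)/complexI.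
- move=> s s0; rewrite /unit_circle /= normrM z01 mul1r normrM normfV.
  have -> : `|1 + 'i * s%:C| = `|1 - 'i * s%:C|.
    rewrite !normc_def /= !(mul0r, mul1r, mulr0, subr0, add0r, addr0, sub0r).
    by rewrite sqrrN !oppr0 addr0.
  by rewrite mulfV // normr_eq0.
- move=> s s0.
  have -> : z0 * ((1 + 'i * s%:C) / (1 - 'i * s%:C)) - z0 =
            z0 * (2 * ('i * s%:C)) / (1 - 'i * s%:C).
    by field; exact: nz.
  rewrite -lecR -modulusE !normrM z01 mul1r normfV normCi mul1r normr_realC.
  rewrite ler_pdivrMr ?normr_gt0 // gtr0_norm //.
  rewrite (gtr0_norm s0) rmorphM rmorph_nat ler_peMr ?ni //.
  by rewrite mulr_ge0 // lecR ltW.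
Qed.

(** At a pole the evaluation has the conventional value 0, but it is unbounded
    nearby, hence not even continuous. *)
Lemma derivable_regular (f : ratfun R) (z : C) :
  derivable (rat_eval f : C^o -> C^o) z 1 -> regular_at f z.
Proof.
move=> /derivable1_diffP/differentiable_continuous cf.
pose B := modulus (rat_eval f z) + 1.
have cm := continuous_modulus_comp cf.
have : \forall w \near (z : C^o), modulus (rat_eval f w) < B.
  by apply: (cvgr_lt _ cm); rewrite ltrDl.
move=> /nbhs_ballP[e /posC_real[r r0 ->]] H.
apply: (@bounded_regular [set w | modulus (w - z) < r] z 1 f B).
- move=> e1 d e10 d0.
  have [w [_ wz dw]] := @generically_near_setT z (Num.min r e1) d ltac:(by rewrite lt_min r0 e10) d0.
  by exists w; move: wz; rewrite lt_min => /andP[]; split.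
- exact: oner_neq0.
- move=> w /= wz _; apply/ltW/H.
  by rewrite -ball_normE /= distrC modulusE ltcR.
Qed.

End Accumulation.

(** * Maximum principle on the closed unit disk *)

Section MaximumPrinciple.
Variable R : realType.
Local Notation C := R[i].

Lemma cis_norm (t : R) : `|cis t| = 1.
Proof. by rewrite /cis normc_def /= cos2Dsin2 sqrtr1. Qed.

Lemma continuous_cis : continuous (@cis R : R -> C^o).
Proof.
move=> t; apply: continuous_complex; [exact: continuous_cos|exact: continuous_sin].
Qed.

Lemma cis_surj (z : C) : `|z| = 1 -> exists2 t : R, t \in `[- pi, pi] & cis t = z.
Proof.
case: z => x y; rewrite normc_def /= => /complexI/(congr1 (fun x => x ^+ 2)).
rewrite sqr_sqrtr ?addr_ge0 ?sqr_ge0 // expr1n => xy.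
have x1 : -1 <= x <= 1.
  by rewrite -ler_norml -ler_sqr ?nnegrE // expr1n -xy real_normK ?num_real // lerDl sqr_ge0.
have yE : Num.sqrt (1 - x ^+ 2) = `|y|.
  by rewrite -xy addrAC subrr add0r sqrtr_sqr.
have [y0|y0] := leP 0 y.
  exists (acos x); last by rewrite /cis acosK // sin_acos // yE ger0_norm.
  by rewrite in_itv /= acos_lepi // andbT (le_trans _ (acos_ge0 x1)) // oppr_le0 pi_ge0.
exists (- acos x).
  rewrite in_itv /= lerN2 acos_lepi //= (@le_trans _ _ 0) ?pi_ge0 //.
  by rewrite oppr_le0 acos_ge0.
by rewrite /cis cosN sinN acosK // sin_acos // yE ltr0_norm // opprK.
Qed.

Definition closed_disk : set C^o := [set w | modulus w <= 1].

Lemma closed_disk_compact : compact closed_disk.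
Proof.
pose h (p : R * R) : C^o := p.1 +i* p.2.
have ch : continuous h.
  by move=> p; apply: continuous_complex; [exact: cvg_fst|exact: cvg_snd].
apply: (@subclosed_compact _ _ (h @` (`[-1, 1] `*` `[-1, 1])%classic)).
- apply: (@closed_comp C^o R (@modulus R) [set x | x <= 1]); last exact: closed_le.
  by move=> x _; exact: continuous_modulus.
- apply: continuous_compact; first exact/continuous_subspaceT.
  by apply: compact_setX; exact: segment_compact.
- move=> [x y]; rewrite /closed_disk /= => xy1.
  have bnd (r : R) : `|r|%:C <= `|x +i* y| -> -1 <= r <= 1.
    by rewrite modulusE lecR => rxy; rewrite -ler_norml (le_trans rxy).
  exists (x, y) => //; split; rewrite /= in_itv /=; apply: bnd.
    exact: (normc_ge_Re (x +i* y)).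
  exact: (normc_ge_Im (x +i* y)).
Qed.

Lemma Re_realM (r : R) (z : C) : complex.Re (r%:C * z) = r * complex.Re z.
Proof. by case: z => a b /=; rewrite mul0r subr0. Qed.

Lemma modulus_ge_Re (z : C) : complex.Re z <= modulus z.
Proof. by rewrite (le_trans (ler_norm _)) // -lecR -modulusE normc_ge_Re. Qed.

Lemma modulusM (x y : C) : modulus (x * y) = modulus x * modulus y.
Proof. by apply: complexI; rewrite rmorphM -!modulusE normrM. Qed.

Lemma modulus_gt0 (z : C) : z != 0 -> 0 < modulus z.
Proof. by rewrite -ltcR -modulusE normr_gt0. Qed.

(** Write P = a Q + (z - w0)^k S with S(w0) nonzero.  Along w = w0 + t u, where u^k is
    the quotient of a by S(w0) / Q(w0), the value of P / Q is a (1 + t^k g(w)) with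
    g(w0) = 1, and its modulus exceeds that of a for small t > 0. *)
Lemma local_increase (P Q : {poly C}) (w0 a : C) :
  modulus w0 < 1 -> Q.[w0] != 0 -> P.[w0] = a * Q.[w0] -> a != 0 ->
  P - a *: Q != 0 ->
  exists w, [/\ modulus w <= 1, Q.[w] != 0 & modulus a < modulus (P.[w] / Q.[w])].
Proof.
move=> w01 Qw0 Pw0 a0 N0.
have [k [S]] := multiplicity_XsubC (P - a *: Q) w0.
rewrite N0 /= => Sw0 NE.
have k0 : (0 < k)%N.
  rewrite lt0n; apply: contra Sw0 => /eqP k0.
  by rewrite k0 expr0 mulr1 in NE; rewrite -NE /root !hornerE Pw0 subrr.
pose c := S.[w0] / Q.[w0].
have c0 : c != 0 by rewrite mulf_neq0 ?invr_eq0.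
pose u := k.-root (a / c).
have uk : u ^+ k = a / c by rewrite rootCK.
pose g (w : C^o) : C^o := S.[w] / Q.[w] / c.
have cg : {for (w0 : C^o), continuous g}.
  apply: continuousM; last exact: cst_continuous.
  apply: continuousM; first exact: continuous_hornerC.
  by apply: continuousV => //; exact: continuous_hornerC.
have g1 : complex.Re (g w0) = 1 by rewrite /g -/c mulfV.
have cRg : {for (w0 : C^o), continuous (fun w : C^o => complex.Re (g w))}.
  by apply: (@continuous_comp C^o C^o R g (@complex.Re R) w0 cg); exact: continuous_Re.
have near1 : \forall w \near (w0 : C^o), 0 < complex.Re (g w).
  by apply: (cvgr_gt _ cRg); rewrite g1 ltr01.
have near2 : \forall w \near (w0 : C^o), modulus w < 1.
  by apply: (cvgr_lt _ (@continuous_modulus R w0)).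
have near3 : \forall w \near (w0 : C^o), 0 < modulus Q.[w].
  apply: (cvgr_gt _ (continuous_modulus_comp (@continuous_hornerC R Q w0))).
  exact: modulus_gt0.
have : \forall w \near (w0 : C^o),
    0 < complex.Re (g w) /\ modulus w < 1 /\ 0 < modulus Q.[w].
  by near=> w; split; [near: w|split; near: w].
move=> /nbhs_ballP[e /posC_real[r r0 ->] H].
pose t := r / (modulus u + 1).
have u10 : 0 < modulus u + 1 by rewrite ltr_wpDl ?modulus_ge0.
have t0 : 0 < t by rewrite divr_gt0.
pose w := w0 + t%:C * u.
have [gw [wlt Qw]] : 0 < complex.Re (g w) /\ modulus w < 1 /\ 0 < modulus Q.[w].
  apply: H; rewrite -ball_normE /= /w opprD addrA subrr add0r normrN.
  rewrite modulusE ltcR modulusM [modulus t%:C]/modulus normr_realC gtr0_norm //.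
  by rewrite /t /= mulrAC -mulrA gtr_pMr // ltr_pdivrMr // mul1r ltrDl.
have Qw0' : Q.[w] != 0 by apply: contraTneq Qw => ->; rewrite /modulus normr0 ltxx.
exists w; split; [exact: ltW|by []|].
have -> : P.[w] / Q.[w] = a * (1 + (t ^+ k)%:C * g w).
  have wE : w - w0 = t%:C * u by rewrite /w addrAC subrr add0r.
  have -> : P.[w] = S.[w] * (t%:C * u) ^+ k + a * Q.[w].
    have -> : P = S * ('X - w0%:P) ^+ k + a *: Q by rewrite -NE subrK.
    by rewrite -wE !hornerE.
  have tk : (t ^+ k)%:C = t%:C ^+ k :> C by rewrite rmorphXn.
  have alg (x y q : C) : q != 0 -> (y * (x * (a / c)) + a * q) / q = a * (1 + x * (y / q / c)).
    by move=> q0; field; rewrite q0 c0.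
  by rewrite exprMn uk (alg _ _ _ Qw0') -tk.
rewrite modulusM ltr_pMr ?modulus_gt0 //.
rewrite (lt_le_trans _ (modulus_ge_Re _)) // raddfD /= Re_realM ltrDl.
by rewrite mulr_gt0 // exprn_gt0.
Unshelve. all: by end_near. Qed.

(** The maximum over the compact disk is attained; by [local_increase] it is attained on
    the circle, unless P / Q is constant or the maximum is 0. *)
Lemma maximum_principle (P Q : {poly C}) (B : R) :
  (forall w, modulus w <= 1 -> Q.[w] != 0) ->
  (forall w, modulus w = 1 -> modulus (P.[w] / Q.[w]) <= B) ->
  forall w, modulus w <= 1 -> modulus (P.[w] / Q.[w]) <= B.
Proof.
move=> Q0 hB w1 w1D.
pose h (w : C^o) : C^o := P.[w] / Q.[w].
have ch : {within closed_disk, continuous (fun w : C^o => modulus (h w))}.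
  apply: continuous_in_subspaceT => w /[!inE] wD.
  apply: continuous_modulus_comp; apply: continuousM; first exact: continuous_hornerC.
  by apply: continuousV; [exact: Q0|exact: continuous_hornerC].
have m1 : modulus (1 : C) = 1 by rewrite /modulus normr1.
have ne : closed_disk !=set0 by exists (1 : C); rewrite /closed_disk /= m1.
have [w0 /[!inE] w0D w0max] := compact_EVT_max ne closed_disk_compact ch.
have {}w0max w : modulus w <= 1 -> modulus (P.[w] / Q.[w]) <= modulus (P.[w0] / Q.[w0]).
  by move=> wD; apply: w0max; rewrite inE.
apply: (le_trans (w0max _ w1D)).
pose a := P.[w0] / Q.[w0]; rewrite -/a.
have Qw0 : Q.[w0] != 0 by exact: Q0.
have B0 : 0 <= B by rewrite (le_trans _ (hB 1 m1)) ?modulus_ge0.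
have [w0lt|w0ge] := ltP (modulus w0) 1; last first.
  by apply: hB; apply/eqP; rewrite eq_le w0ge andbT.
have [->|a0] := eqVneq a 0; first by rewrite /modulus normr0.
have Pw0 : P.[w0] = a * Q.[w0] by rewrite /a divfK.
have [N0|N0] := eqVneq (P - a *: Q) 0.
  rewrite (le_trans _ (hB 1 m1)) //.
  have -> : P = a *: Q by apply/eqP; rewrite -subr_eq0 N0.
  by rewrite hornerZ mulfK // Q0 // m1.
have [w [wD _]] := local_increase w0lt Qw0 Pw0 a0 N0.
by rewrite ltNge w0max.
Qed.

End MaximumPrinciple.

(** * Operator bounds on the circle and outside the disk *)

Section OperatorBoundPropagation.
Variable R : realType.
Local Notation C := R[i].
Local Open Scope sesquilinear_scope.

Definition bilin n (G : 'M[ratfun R]_n) (u w : 'cV[C]_n) (z : C) : C :=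
  (u ^t* *m rat_evalmx G z *m w) 0 0.

Lemma bilinE n (G : 'M[ratfun R]_n) (u w : 'cV[C]_n) (z : C) :
  bilin G u w z = \sum_j \sum_i (u ^t*) 0 i * rat_eval (G i j) z * w j 0.
Proof.
rewrite /bilin mxE; apply: eq_bigr => j _; rewrite mxE mulr_suml.
by apply: eq_bigr => i _; rewrite [rat_evalmx _ _ _ _]mxE.
Qed.

Lemma continuous_mx_bilin n (Psi : C -> 'M[C]_n) (u w : 'cV[C]_n) (z : C) :
  (forall i j, {for (z : C^o), continuous (fun x : C^o => Psi x i j : C^o)}) ->
  {for (z : C^o), continuous (fun x : C^o => (u ^t* *m Psi x *m w) 0 0 : C^o)}.
Proof.
move=> cPsi; have -> : (fun x : C^o => (u ^t* *m Psi x *m w) 0 0 : C^o) =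
    (fun x : C^o => \sum_j \sum_i (u ^t*) 0 i * Psi x i j * w j 0 : C^o).
  apply/funext => x; rewrite mxE; apply: eq_bigr => j _.
  by rewrite mxE mulr_suml.
have csum (F : 'I_n -> C^o -> C^o) : (forall i, {for (z : C^o), continuous (F i)}) ->
    {for (z : C^o), continuous (fun x : C^o => \sum_i F i x)}.
  move=> cF; elim: (index_enum _) => [|i r IH].
    have -> : (fun x : C^o => \sum_(j <- [::]) F j x : C^o) = (cst 0 : C^o -> C^o).
      by apply/funext => x; rewrite big_nil.
    exact: (@cst_continuous C^o C^o 0 z).
  have -> : (fun x : C^o => \sum_(j <- i :: r) F j x : C^o) =
      (F i : C^o -> C^o) + (fun x : C^o => \sum_(j <- r) F j x : C^o).
    by apply/funext => x; rewrite big_cons.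
  exact: (@continuousD C^o C^o C^o _ _ z (cF i) IH).
apply: (csum _) => j; apply: (csum _) => i.
apply: continuousM; last exact: cst_continuous.
by apply: continuousM; first exact: cst_continuous.
Qed.

Lemma continuous_rat_evalmx m n (G : 'M[ratfun R]_(m, n)) (z : C) i j :
  mx_regular_at G z ->
  {for (z : C^o), continuous (fun x : C^o => rat_evalmx G x i j : C^o)}.
Proof.
move=> rG; have -> : (fun x : C^o => rat_evalmx G x i j : C^o) = rat_eval (G i j).
  by apply/funext => x; rewrite mxE.
exact: regular_continuous.
Qed.

Lemma bilin_continuous n (G : 'M[ratfun R]_n) (u w : 'cV[C]_n) (z : C) :
  mx_regular_at G z -> {for (z : C^o), continuous (bilin G u w : C^o -> C^o)}.
Proof.
by move=> rG; apply: continuous_mx_bilin => i j; exact: continuous_rat_evalmx.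
Qed.

Definition bilin_bound n (l : R) (u w : 'cV[C]_n) : R :=
  l * (complex.Re (nsq u) * complex.Re (nsq w)).

Lemma nsq_Re n (u : 'cV[C]_n) : nsq u = (complex.Re (nsq u))%:C.
Proof. by rewrite RRe_real // ger0_real // nsq_ge0. Qed.

Lemma opbound_bilin n (G : 'M[ratfun R]_n) (l : R) (z : C) :
  opbound (rat_evalmx G z) l <->
  forall u w, modulus (bilin G u w z) ^+ 2 <= bilin_bound l u w.
Proof.
have E u w : l%:C * (nsq u * nsq w) = (bilin_bound l u w)%:C :> C.
  by rewrite {1}(nsq_Re u) {1}(nsq_Re w) -!rmorphM.
split=> bG u w; have := bG u w; rewrite -/(bilin G u w z) modulusE E -rmorphXn lecR //.
Qed.

(** Weak inequalities between continuous functions pass to accumulation points. *)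
Lemma opbound_closure n (G : 'M[ratfun R]_n) (l : R) (S : set C) (z0 : C) (d : {poly R}) :
  generically_near S z0 -> d != 0 -> mx_regular_at G z0 ->
  (forall z, S z -> peval d z != 0 -> opbound (rat_evalmx G z) l) ->
  opbound (rat_evalmx G z0) l.
Proof.
move=> Sz0 d0 rG bG; apply/opbound_bilin => u w; rewrite -subr_le0.
apply: (@generically_near_le _ S z0 d
    (fun z : C^o => modulus (bilin G u w z) ^+ 2 - bilin_bound l u w) Sz0 d0).
  apply: continuousB; last exact: cst_continuous.
  have cm := continuous_modulus_comp (@bilin_continuous _ G u w z0 rG).
  exact: (continuousM cm cm).
by move=> z Sz dz; rewrite subr_le0; apply: (opbound_bilin _ _ _).1; exact: bG.
Qed.

(** The scalar functions to which the maximum principle applies; they are closed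
    under linear combinations. *)
Definition disk_quotient (h : C -> C) : Prop :=
  exists P Q : {poly C}, forall w, modulus w <= 1 -> Q.[w] != 0 /\ h w = P.[w] / Q.[w].

Lemma disk_quotient_max (h : C -> C) (B : R) : disk_quotient h ->
  (forall w, modulus w = 1 -> modulus (h w) <= B) ->
  forall w, modulus w <= 1 -> modulus (h w) <= B.
Proof.
move=> [P [Q PQ]] hB w w1; rewrite (PQ w w1).2.
apply: maximum_principle w1 => [z z1|z z1]; first exact: (PQ z z1).1.
by rewrite -(PQ z _).2 ?z1 // hB.
Qed.

Lemma disk_quotientD (h k : C -> C) : disk_quotient h -> disk_quotient k ->
  disk_quotient (fun w => h w + k w).
Proof.
move=> [P [Q PQ]] [P' [Q' PQ']]; exists (P * Q' + P' * Q), (Q * Q') => w w1.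
have [Q0 ->] := PQ w w1; have [Q'0 ->] := PQ' w w1.
by rewrite !hornerE mulf_neq0 // addf_div.
Qed.

Lemma disk_quotient_scale (h : C -> C) (a b : C) : disk_quotient h ->
  disk_quotient (fun w => a * h w * b).
Proof.
move=> [P [Q PQ]]; exists ((a * b) *: P), Q => w w1.
by have [Q0 ->] := PQ w w1; rewrite hornerZ mulrAC mulrA.
Qed.

Lemma disk_quotient_sum (I : Type) (r : seq I) (F : I -> C -> C) :
  (forall i, disk_quotient (F i)) -> disk_quotient (fun w => \sum_(i <- r) F i w).
Proof.
move=> dF; elim: r => [|i r IH].
  by exists 0, 1 => w _; rewrite big_nil !hornerE ?mul0r oner_neq0.
have [P [Q PQ]] := disk_quotientD (dF i) IH; exists P, Q => w w1.
by rewrite big_cons; exact: PQ.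
Qed.

Lemma regular_disk_quotient (f : ratfun R) :
  (forall w, modulus w <= 1 -> regular_at f w) -> disk_quotient (rat_eval f).
Proof.
move=> rf; have [p [q [cpq q0 fE fz]]] := coprime_representation f.
exists (map_poly (real_complex R) p), (map_poly (real_complex R) q) => w w1.
split; last exact: fz.
by apply: (coprime_ratio_regular cpq q0); rewrite -fE; exact: rf.
Qed.

(** The second clause is regularity at infinity. *)
Definition regular_outside n (G : 'M[ratfun R]_n) : Prop :=
  (forall z, 1 <= `|z| -> mx_regular_at G z) /\
  mx_regular_at (map_mx (@rat_recip R) G) 0.

Lemma regular_outside_circle n (G : 'M[ratfun R]_n) (z : C) :
  regular_outside G -> unit_circle z -> mx_regular_at G z.
Proof. by move=> [rG _] z1; apply: rG; rewrite (z1 : `|z| = 1). Qed.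

(** Outwards this is the maximum principle for the coefficients of G(1/w), where
    w = 0 stands for the point at infinity; inwards it is continuity. *)
Lemma opbound_outside n (G : 'M[ratfun R]_n) (l : R) : regular_outside G ->
  (forall z, unit_circle z -> opbound (rat_evalmx G z) l) <->
  (forall z, 1 < `|z| -> opbound (rat_evalmx G z) l).
Proof.
move=> [rG rG0]; split=> bG z z1; last first.
  apply: (@opbound_closure _ _ _ [set z | 1 < `|z|] z 1).
  - exact: generically_near_outside.
  - exact: oner_neq0.
  - by apply: rG; rewrite z1.
  - by move=> w /bG.
pose G' := map_mx (@rat_recip R) G.
have G'E w : w != 0 -> modulus w <= 1 ->
    mx_regular_at G' w /\ rat_evalmx G' w = rat_evalmx G w^-1.
  move=> w0 w1; have rw : mx_regular_at G w^-1.
    by apply: rG; rewrite normfV invf_ge1 ?normr_gt0 // modulusE lecR.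
  split; first by move=> i j; rewrite mxE; exact: (rat_recip_eval w0 (rw i j)).1.
  by apply/matrixP => i j; rewrite !mxE; exact: (rat_recip_eval w0 (rw i j)).2.
have rG' w : modulus w <= 1 -> mx_regular_at G' w.
  by have [->//|w0] := eqVneq w 0; move/(G'E _ w0) => [].
have z0 : z != 0 by rewrite -normr_gt0 (lt_trans _ z1).
have zV1 : modulus z^-1 <= 1.
  by rewrite -lecR -modulusE normfV invf_le1 ?ltW // normr_gt0.
have zV0 : z^-1 != 0 by rewrite invr_eq0.
rewrite -[z]invrK -(G'E _ zV0 zV1).2; apply/opbound_bilin => u w.
have bound v : modulus v = 1 -> modulus (bilin G' u w v) ^+ 2 <= bilin_bound l u w.
  move=> v1; have v0 : v != 0 by rewrite -normr_gt0 modulusE v1 ltr01.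
  move: u w; apply/opbound_bilin; rewrite (G'E _ v0 _).2 ?v1 //; apply: bG.
  by rewrite /unit_circle /= normfV modulusE v1 invr1.
have K0 : 0 <= bilin_bound l u w.
  by rewrite (le_trans _ (bound 1 _)) ?sqr_ge0 // /modulus normr1.
rewrite -(sqr_sqrtr K0) ler_sqr ?nnegrE ?modulus_ge0 ?sqrtr_ge0 //.
move: (z^-1) zV1; apply: disk_quotient_max => [|v v1]; last first.
  by rewrite -ler_sqr ?nnegrE ?modulus_ge0 ?sqrtr_ge0 // sqr_sqrtr // bound.
have [P [Q PQ]] : disk_quotient
    (fun z => \sum_j \sum_i (u ^t*) 0 i * rat_eval (G' i j) z * w j 0).
  apply: disk_quotient_sum => j; apply: disk_quotient_sum => i.
  apply: disk_quotient_scale; apply: regular_disk_quotient => v v1; exact: rG'.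
by exists P, Q => v v1; rewrite bilinE; exact: PQ.
Qed.

Definition circle_continuous (f : C -> C) : Prop :=
  forall z, unit_circle z -> {for (z : C^o), continuous (f : C^o -> C^o)}.

Lemma circle_bounded (f : C -> C) : circle_continuous f ->
  exists B : R, forall z, unit_circle z -> modulus (f z) <= B.
Proof.
move=> cf; pose F (t : R) := modulus (f (cis t)).
have cF : {within `[- pi, pi], continuous F}.
  apply: continuous_subspaceT => t.
  apply: (@continuous_comp R C^o R (@cis R) (fun z => modulus (f z)) t).
    exact: continuous_cis.
  by apply: continuous_modulus_comp; apply: cf; exact: cis_norm.
have pipi : - pi <= pi :> R by rewrite ge0_cp // pi_ge0.
have [c _ cmax] := EVT_max pipi cF.
by exists (F c) => z /cis_surj[t tpi <-]; exact: cmax.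
Qed.

Lemma opbound_circle_exists n (G : 'M[ratfun R]_n) :
  (forall z, unit_circle z -> mx_regular_at G z) ->
  exists2 l : R, 0 <= l & forall z, unit_circle z -> opbound (rat_evalmx G z) l.
Proof.
move=> rG.
have /choice[B0 B0P] (ij : 'I_n * 'I_n) : exists B : R, forall z, unit_circle z ->
    modulus (rat_eval (G ij.1 ij.2) z) <= B.
  by apply: circle_bounded => z z1; apply: regular_continuous; exact: rG.
pose l := \sum_i \sum_j B0 (i, j) ^+ 2.
exists l => [|z z1]; first by rewrite sumr_ge0 // => i _; rewrite sumr_ge0 // => j _; exact: sqr_ge0.
apply: opbound_frobenius; rewrite /l raddf_sum ler_sum // => i _.
rewrite nsqE raddf_sum ler_sum // => j _.
rewrite !mxE norm_conjC modulusE -rmorphXn lecR lerXn2r ?nnegrE ?modulus_ge0 //.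
  by rewrite (le_trans _ (B0P (i, j) z z1)) // modulus_ge0.
exact: B0P (i, j) z z1.
Qed.

End OperatorBoundPropagation.

(** * The cone of spectral densities, pointwise *)

Section SpectralCone.
Variable R : realType.
Local Notation C := R[i].
Local Notation mu := (@lebesgue_measure R).
Local Open Scope sesquilinear_scope.

Lemma circle_continuous_Re (g : C -> C) : circle_continuous g ->
  continuous (fun t : R => complex.Re (g (cis t))).
Proof.
move=> cg t; apply: (@continuous_comp R C^o R (@cis R) (fun z => complex.Re (g z)) t).
  exact: continuous_cis.
apply: (@continuous_comp C^o C^o R g (@complex.Re R)); last exact: continuous_Re.
by apply: cg; exact: cis_norm.
Qed.

Lemma circle_continuous_Im (g : C -> C) : circle_continuous g ->
  continuous (fun t : R => complex.Im (g (cis t))).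
Proof.
move=> cg t; apply: (@continuous_comp R C^o R (@cis R) (fun z => complex.Im (g z)) t).
  exact: continuous_cis.
apply: (@continuous_comp C^o C^o R g (@complex.Im R)); last exact: continuous_Im.
by apply: cg; exact: cis_norm.
Qed.

Lemma circle_continuous_measurable (g : C -> C) :
  circle_continuous g -> circle_measurable g.
Proof.
move=> cg; split; apply: measurable_funTS; apply: continuous_measurable_fun.
  exact: circle_continuous_Re.
exact: circle_continuous_Im.
Qed.

Lemma Rintegral_continuous_gt0 (g : R -> R) (a b t0 : R) : a < b ->
  continuous g -> (forall t, a <= t <= b -> 0 <= g t) ->
  a <= t0 <= b -> 0 < g t0 -> 0 < \int[mu]_(t in `[a, b]) g t.
Proof.
move=> ab cg g0 /andP[at0 t0b] gt0.
have ig : mu.-integrable `[a, b] (EFin \o g).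
  apply: continuous_compact_integrable; first exact: segment_compact.
  exact: continuous_subspaceT.
pose m := g t0 / 2; have m0 : 0 < m by rewrite divr_gt0.
have : \forall t \near t0, m < g t.
  by apply: (cvgr_gt _ (cg t0)); rewrite /m ltr_pdivrMr // ltr_pMr // ltr1n.
move=> /nbhs_ballP[r /= r0 Hr].
pose lo := Num.max a (t0 - r / 2); pose hi := Num.min b (t0 + r / 2).
have r2 : 0 < r / 2 by rewrite divr_gt0.
have lohi : lo < hi.
  rewrite gt_max !lt_min ab /= (le_lt_trans at0) ?ltrDl //.
  rewrite (lt_le_trans _ t0b) ?gtrBl //= ltrD2l.
  by rewrite (lt_trans _ r2) // oppr_lt0.
have sub : `[lo, hi] `<=` `[a, b].
  move=> t; rewrite /= !in_itv /= ge_max le_min.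
  by move=> /andP[/andP[-> _] /andP[-> _]].
have gm t : lo <= t <= hi -> m <= g t.
  rewrite ge_max le_min => /andP[/andP[_ t1] /andP[_ t2]]; apply/ltW/Hr.
  have rr : r / 2 < r by rewrite ltr_pdivrMr // ltr_pMr // ltr1n.
  rewrite -ball_normE /= ltr_norml; apply/andP; split; lra.
rewrite -lte_fin /Rintegral fineK; last exact: integrable_fin_num.
have mg : measurable_fun `[a, b] (EFin \o g).
  by apply/measurable_EFinP/measurable_funTS; exact: continuous_measurable_fun.
apply: (@lt_le_trans _ _ (\int[mu]_(t in `[lo, hi]) m%:E)%E).
  rewrite integral_cst //= lebesgue_measure_itv /= lte_fin lohi -EFinD -EFinM lte_fin.
  by rewrite mulr_gt0 // subr_gt0.
apply: (@le_trans _ _ (\int[mu]_(t in `[lo, hi]) (g t)%:E)%E).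
  apply: ge0_le_integral => //.
  - by move=> t _; rewrite lee_fin ltW.
  - exact: measurable_funS mg.
exact: ge0_subset_integral.
Qed.

(** If the quadratic form of Psi were negative at z0 on v, it would stay negative near
    z0, and the product of v with a continuous bump supported there would violate
    the integral inequality. *)
Lemma Splus_pointwise n (Psi : C -> 'M[C]_n) :
  (forall i j, circle_continuous (fun z => Psi z i j)) ->
  (forall z, unit_circle z -> (Psi z) ^t* = Psi z) ->
  Splus Psi <-> forall z, unit_circle z -> forall v : 'cV[C]_n, 0 <= (v ^t* *m Psi z *m v) 0 0.
Proof.
move=> cPsi hPsi; split=> [[_ _ _ pos] z0 z01 v|pos]; last first.
  split=> //.
  - by move=> i j; exact: circle_continuous_measurable.
  - have /choice[B BP] (ij : 'I_n * 'I_n) : exists B : R, forall z, unit_circle z ->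
        modulus (Psi z ij.1 ij.2) <= B by apply: circle_bounded; exact: cPsi.
    exists (\sum_ij `|B ij|) => z z1 i j; rewrite modulusE lecR.
    rewrite (le_trans (BP (i, j) z z1)) // (le_trans (ler_norm _)) //.
    by rewrite (bigD1 (i, j)) //= lerDl sumr_ge0.
  - move=> f _; rewrite /inner2 /circle_integral.
    have fpos (t : R) : 0 <= ((f (cis t)) ^t* *m (Psi (cis t) *m f (cis t))) 0 0.
      by rewrite mulmxA; apply: pos; exact: cis_norm.
    have ReP t : 0 <= complex.Re (((f (cis t)) ^t* *m (Psi (cis t) *m f (cis t))) 0 0).
      by have := fpos t; rewrite lecE => /andP[].
    have ImP t : complex.Im (((f (cis t)) ^t* *m (Psi (cis t) *m f (cis t))) 0 0) = 0.
      by have := fpos t; rewrite lecE => /andP[/eqP].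
    rewrite lecE /=; apply/andP; split.
      rewrite (@eq_Rintegral _ _ _ mu _ (cst 0)); last by move=> t _; rewrite ImP.
      by rewrite Rintegral_cst ?mul0r //; exact: measurable_itv.
    by rewrite divr_ge0 ?mulr_ge0 ?pi_ge0 // Rintegral_ge0.
pose q z := (v ^t* *m Psi z *m v) 0 0.
have cq : circle_continuous q.
  by move=> z z1; apply: continuous_mx_bilin => i j; exact: cPsi.
have qreal z : unit_circle z -> complex.Im (q z) = 0.
  move=> z1; have qz : q z \is Num.real.
    have qE : (v ^t* *m Psi z *m v) ^t* = v ^t* *m Psi z *m v.
      by rewrite !adj_mul trmxCK hPsi // mulmxA.
    by apply/CrealP; rewrite /q -{2}qE [RHS]mxE; congr Num.conj; rewrite [RHS]mxE.
  by have [k ->] := complex_realP _ qz.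
rewrite lecE -/(q z0) (qreal _ z01) eqxx /= leNgt; apply/negP => qneg.
have cRq : {for (z0 : C^o), continuous (fun z : C^o => complex.Re (q z))}.
  apply: (@continuous_comp C^o C^o R q (@complex.Re R) z0); first exact: cq.
  exact: continuous_Re.
have : \forall z \near (z0 : C^o), complex.Re (q z) < 0 by exact: (cvgr_lt _ cRq).
move=> /nbhs_ballP[e /posC_real[r r0 ->] H].
have {}H z : modulus (z - z0) < r -> complex.Re (q z) < 0.
  by move=> zr; apply: H; rewrite -ball_normE /= distrC modulusE ltcR.
(* The bump: twice the positive part of r - |z - z0|. *)
pose x (z : C^o) : R := r - modulus (z - z0).
pose phi (z : C^o) : R := x z + `|x z|.
have cphi (z : C^o) : {for z, continuous phi}.
  have cx : {for z, continuous x}.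
    apply: continuousB; first exact: cst_continuous.
    apply: (continuous_modulus_comp (f := fun z => z - z0)).
    by apply: continuousB; [exact: (fun A => id)|exact: cst_continuous].
  apply: continuousD => //.
  by apply: (continuous_comp cx); exact: norm_continuous.
have cphiC : circle_continuous (fun z => (phi z)%:C).
  move=> z _; have -> : (fun z : C^o => (phi z)%:C : C^o) = (fun z : C^o => phi z +i* 0 : C^o) by [].
  by apply: continuous_complex; [exact: cphi|exact: cst_continuous].
pose f (z : C) : 'cV[C]_n := (phi z)%:C *: v.
have ff (A : 'M[C]_n) z : ((f z) ^t* *m (A *m f z)) 0 0 =
    (phi z)%:C * (phi z)%:C * (v ^t* *m A *m v) 0 0.
  rewrite /f -[((phi z)%:C *: v) ^t*]/(map_mx _ _) linearZ /= map_mxZ /=.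
  rewrite conj_Creal ?complex_real // -scalemxAr -scalemxAr -scalemxAl scalerA.
  by rewrite [LHS]mxE mulmxA.
have cmul (c : C -> C) : circle_continuous c ->
    circle_continuous (fun z => (phi z)%:C * (phi z)%:C * c z).
  move=> cc z z1; apply: continuousM; last exact: cc.
  by apply: continuousM; exact: cphiC.
have Lf : L2 f.
  split.
    move=> i; apply: circle_continuous_measurable => z z1.
    have -> : (fun z : C^o => f z i 0 : C^o) = (fun z : C^o => (phi z)%:C * v i 0 : C^o).
      by apply/funext => w; rewrite mxE.
    by apply: continuousM; [exact: cphiC|exact: cst_continuous].
  suff cff : continuous (fun t : R => complex.Re (((f (cis t)) ^t* *m f (cis t)) 0 0)).
    have : mu.-integrable `[- pi, pi]
        (EFin \o fun t : R => complex.Re (((f (cis t)) ^t* *m f (cis t)) 0 0)).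
      apply: continuous_compact_integrable; first exact: segment_compact.
      exact: continuous_subspaceT.
    by move=> /integrable_lty; apply; exact: measurable_itv.
  apply: (circle_continuous_Re (g := fun z => ((f z) ^t* *m f z) 0 0)).
  have -> : (fun z => ((f z) ^t* *m f z) 0 0) =
      (fun z => (phi z)%:C * (phi z)%:C * (v ^t* *m v) 0 0).
    by apply/funext => z; have := ff 1%:M z; rewrite mul1mx mulmx1.
  by apply: cmul => z _; exact: cst_continuous.
have := pos f Lf; rewrite /inner2 /circle_integral lecE /= => /andP[_].
apply/negP; rewrite -ltNge.
rewrite pmulr_llt0 ?invr_gt0 ?mulr_gt0 ?pi_gt0 //.
pose g (t : R) := - complex.Re ((phi (cis t))%:C * (phi (cis t))%:C * q (cis t)).
have cg : continuous g.
  move=> t; apply: continuousN.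
  by apply: (@circle_continuous_Re (fun z => (phi z)%:C * (phi z)%:C * q z)); exact: cmul.
have gE t : g t = phi (cis t) ^+ 2 * - complex.Re (q (cis t)).
  by rewrite /g -rmorphM Re_realM mulrN expr2.
have [t0 t0pi t0z] := cis_surj z01.
have pipi : - pi < pi :> R by rewrite gtrN ?pi_gt0.
rewrite (@eq_Rintegral _ _ _ mu _ (fun t => -1 * g t)); last first.
  by move=> t _; rewrite ff mulN1r opprK.
have ig : mu.-integrable `[- pi, pi] (EFin \o g).
  apply: continuous_compact_integrable; first exact: segment_compact.
  exact: continuous_subspaceT.
rewrite RintegralZl; [|exact: measurable_itv|exact: ig].
rewrite mulN1r oppr_lt0.
apply: (@Rintegral_continuous_gt0 g _ _ t0) => //.
- move=> t _; rewrite gE; have [xt|xt] := leP (x (cis t)) 0.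
    by rewrite /phi ler0_norm // subrr expr0n mul0r.
  apply: mulr_ge0; first exact: sqr_ge0.
  by rewrite oppr_ge0; apply/ltW/H; rewrite -subr_gt0.
rewrite gE t0z mulr_gt0 ?oppr_gt0 //.
have x0 : 0 < x z0 by rewrite /x subrr /modulus normr0 subr0.
by rewrite exprn_gt0 // /phi gtr0_norm // addr_gt0.
Qed.

End SpectralCone.

(** * Spectral factors *)

Section RationalMatrices.
Variable R : realType.
Local Notation C := R[i].
Local Open Scope sesquilinear_scope.
Implicit Types (f g : ratfun R) (z : C).

Lemma recip_polyD (p q : {poly R}) : recip_poly (p + q) = recip_poly p + recip_poly q.
Proof. by rewrite /recip_poly rmorphD hornerD. Qed.

Lemma rat_recipD f g : rat_recip (f + g) = rat_recip f + rat_recip g.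
Proof.
have [p [q [_ q0 fE _]]] := coprime_representation f.
have [p' [q' [_ q'0 gE _]]] := coprime_representation g.
have qF : tofrac q != 0 :> ratfun R by rewrite tofrac_eq0.
have q'F : tofrac q' != 0 :> ratfun R by rewrite tofrac_eq0.
have qq0 : q * q' != 0 by rewrite mulf_neq0.
have sE : f + g = tofrac (p * q' + p' * q) / tofrac (q * q').
  rewrite (tofracD (p * q') (p' * q)) (tofracM p q') (tofracM p' q) (tofracM q q').
  by rewrite -(addf_div _ _ qF q'F) -fE -gE.
rewrite sE fE gE !rat_recipE // recip_polyD !recip_polyM.
by rewrite addf_div ?recip_poly_neq0.
Qed.

Lemma rat_recipM f g : rat_recip (f * g) = rat_recip f * rat_recip g.
Proof.
have [p [q [_ q0 fE _]]] := coprime_representation f.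
have [p' [q' [_ q'0 gE _]]] := coprime_representation g.
have qq0 : q * q' != 0 by rewrite mulf_neq0.
have sE : f * g = tofrac (p * p') / tofrac (q * q').
  by rewrite (tofracM p p') (tofracM q q') -mulf_div -fE -gE.
by rewrite sE fE gE !rat_recipE // !recip_polyM mulf_div.
Qed.

Lemma rat_recip0 : rat_recip (0 : ratfun R) = 0.
Proof.
by have /eqP := rat_recipD 0 0; rewrite addr0 -subr_eq subrr eq_sym => /eqP.
Qed.

Lemma map_rat_recipM m n l (A : 'M[ratfun R]_(m, n)) (B : 'M[ratfun R]_(n, l)) :
  map_mx (@rat_recip R) (A *m B) = map_mx (@rat_recip R) A *m map_mx (@rat_recip R) B.
Proof.
apply/matrixP => i j; rewrite !mxE (big_morph _ rat_recipD rat_recip0).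
by apply: eq_bigr => k _; rewrite rat_recipM !mxE.
Qed.

Lemma det_regular_eval n (A : 'M[ratfun R]_n) z : mx_regular_at A z ->
  rat_eval (\det A) z = \det (rat_evalmx A z).
Proof.
move=> rA; pose sg (s : 'S_n) : ratfun R := (-1) ^+ s.
have sgE s : sg s = tofrac ((-1) ^+ s) by rewrite rmorphXn rmorphN1.
have rsg s : regular_at (sg s) z by rewrite sgE; exact: regular_tofrac.
have esg s : rat_eval (sg s) z = (-1) ^+ s.
  by rewrite sgE rat_eval_tofrac /peval rmorphXn rmorphN1 horner_exp hornerN hornerC.
have prodE (r : seq 'I_n) s : regular_at (\prod_(i <- r) A i (s i)) z /\
    rat_eval (\prod_(i <- r) A i (s i)) z = \prod_(i <- r) rat_evalmx A z i (s i).
  elim: r => [|i r [IH1 IH2]].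
    by rewrite !big_nil rat_eval1; split=> //; exact: regular1.
  by rewrite !big_cons -IH2 mxE; exact: regularM_eval.
have term s : regular_at (sg s * \prod_i A i (s i)) z /\
    rat_eval (sg s * \prod_i A i (s i)) z = (-1) ^+ s * \prod_i rat_evalmx A z i (s i).
  by rewrite -(esg s) -(prodE _ s).2; apply: regularM_eval => //; exact: (prodE _ s).1.
rewrite /determinant.
have [_ ->] := @regular_sum_eval _ _ (index_enum _) (fun s : 'S_n => sg s * \prod_i A i (s i)) z
  (fun s => (term s).1).
by apply: eq_bigr => s _; exact: (term s).2.
Qed.

Lemma regular_conj f z : regular_at f z ->
  regular_at f (Num.conj z) /\ rat_eval f (Num.conj z) = Num.conj (rat_eval f z).
Proof.
move=> [p [q [qz fE]]].
have qz' : peval q (Num.conj z) != 0 by rewrite peval_conj conjC_eq0.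
split; first by exists p, q.
by rewrite (rat_evalE qz fE) (rat_evalE qz' fE) !peval_conj -fmorph_div.
Qed.

Lemma unit_circle_inv z : unit_circle z -> z^-1 = Num.conj z.
Proof. by rewrite /unit_circle /= => z1; rewrite invC_norm z1 expr1n invr1 mul1r. Qed.

(** Because 1/z is the conjugate of z on the circle and the coefficients are real. *)
Lemma para_adj_eval m n (A : 'M[ratfun R]_(m, n)) z : unit_circle z ->
  mx_regular_at A z ->
  mx_regular_at (para_adj A) z /\ rat_evalmx (para_adj A) z = (rat_evalmx A z) ^t*.
Proof.
move=> z1 rA; have z0 : z != 0 by rewrite -normr_gt0 (z1 : `|z| = 1) ltr01.
have E i j : regular_at (rat_recip (A i j)) z /\
    rat_eval (rat_recip (A i j)) z = Num.conj (rat_eval (A i j) z).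
  have [rc <-] := regular_conj (rA i j); rewrite -(unit_circle_inv z1).
  by apply: rat_recip_eval => //; rewrite (unit_circle_inv z1).
split=> [i j|]; first by rewrite !mxE; exact: (E j i).1.
by apply/matrixP => i j; rewrite !mxE; exact: (E j i).2.
Qed.

Lemma spectral_factor_eval n (Phi W : 'M[ratfun R]_n) z : spectral_factor Phi W ->
  unit_circle z -> mx_regular_at W z ->
  mx_regular_at Phi z /\ rat_evalmx Phi z = rat_evalmx W z *m (rat_evalmx W z) ^t*.
Proof.
move=> -> z1 rW; have [rP <-] := para_adj_eval z1 rW.
exact: mulmx_regular_eval.
Qed.

(** Differentiability of the evaluation excludes poles, at infinity through the
    substitution of 1/z. *)
Lemma minimum_phase_regular n (W : 'M[ratfun R]_n) : minimum_phase W ->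
  regular_outside W /\
  (forall z, 1 < `|z| -> mx_regular_at (invmx W) z) /\
  mx_regular_at (map_mx (@rat_recip R) (invmx W)) 0.
Proof.
move=> [[U [_ subU aW]] aWi]; split; [split|split].
- by move=> z z1 i j; apply: derivable_regular; exact: (aW (Some z) (subU (Some z) z1) i j).
- by move=> i j; rewrite mxE; apply: derivable_regular; exact: (aW None (subU None I) i j).
- by move=> z z1 i j; apply: derivable_regular; exact: (aWi (Some z) z1 i j).
- by move=> i j; rewrite mxE; apply: derivable_regular; exact: (aWi None I i j).
Qed.

Lemma normal_rank_point n (Psi : C -> 'M[C]_n) r : normal_rank Psi r ->
  exists2 z, unit_circle z & \rank (Psi z) = r.
Proof.
move=> [N [mN N0 sub]]; apply: contrapT => nex.
have : (lebesgue_measure (@angles R) <= lebesgue_measure N)%E.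
  apply: le_measure; rewrite ?inE //; first exact: measurable_itv.
  move=> t tA; apply: sub => /= Ht; apply: nex.
  by exists (cis t); [exact: cis_norm|exact: Ht].
rewrite N0 lebesgue_measure_itv /= lte_fin gtrN ?pi_gt0 // -EFinD lee_fin.
by apply/negP; rewrite -ltNge opprK addr_gt0 ?pi_gt0.
Qed.

(** At a point of the circle where Phi has rank n, the determinant of W does not
    vanish. *)
Lemma spectral_factor_unit n (Phi W : 'M[ratfun R]_n) : spectral_factor Phi W ->
  regular_outside W -> normal_rank (rat_evalmx Phi) n -> W \in unitmx.
Proof.
move=> fW rW /normal_rank_point[z z1 rk].
have rWz := regular_outside_circle rW z1.
rewrite unitmxE unitfE; apply/eqP => d0.
have := det_regular_eval rWz; rewrite d0 rat_eval0 => /esym d0z.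
move: rk; rewrite (spectral_factor_eval fW z1 rWz).2 => rk.
have : (rat_evalmx W z *m (rat_evalmx W z) ^t*) \in unitmx.
  by rewrite -row_full_unit /row_full rk.
by rewrite unitmx_mul unitmxE d0z unitr0.
Qed.

End RationalMatrices.

(** * Domination of densities and the norm of the quotient *)

Section Dominance.
Variable R : realType.
Local Notation C := R[i].
Local Open Scope sesquilinear_scope.

Lemma nsq_pencil n (A B : 'M[C]_n) (a b : C) (v : 'cV[C]_n) :
  (v ^t* *m (b *: (B *m B ^t*) - a *: (A *m A ^t*)) *m v) 0 0 =
  b * nsq (B ^t* *m v) - a * nsq (A ^t* *m v).
Proof.
have E (W : 'M[C]_n) : nsq (W ^t* *m v) = (v ^t* *m (W *m W ^t*) *m v) 0 0.
  by rewrite nsq_mul trmxCK.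
rewrite !E mulmxBr mulmxBl -!scalemxAr -!scalemxAl.
by move: (_ *m v) (_ *m v) => X Y; rewrite !mxE.
Qed.

Lemma Sle_pointwise n (Phi1 Phi2 W1 W2 : 'M[ratfun R]_n) (a b : R) :
  spectral_factor Phi1 W1 -> regular_outside W1 ->
  spectral_factor Phi2 W2 -> regular_outside W2 ->
  Splus (fun z => b%:C *: rat_evalmx Phi2 z - a%:C *: rat_evalmx Phi1 z) <->
  forall z, unit_circle z -> forall v : 'cV[C]_n,
    a%:C * nsq ((rat_evalmx W1 z) ^t* *m v) <= b%:C * nsq ((rat_evalmx W2 z) ^t* *m v).
Proof.
move=> f1 r1 f2 r2.
have P1 z (z1 : unit_circle z) := spectral_factor_eval f1 z1 (regular_outside_circle r1 z1).
have P2 z (z1 : unit_circle z) := spectral_factor_eval f2 z1 (regular_outside_circle r2 z1).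
have conjr (c : R) : Num.conj (c%:C : C) = c%:C.
  by rewrite conj_Creal // complex_real.
have herm (W : 'M[C]_n) : (W *m W ^t*) ^t* = W *m W ^t* by rewrite adj_mul trmxCK.
rewrite Splus_pointwise.
- by split=> H z z1 v; have := H z z1 v; rewrite (P1 z z1).2 (P2 z z1).2 nsq_pencil subr_ge0.
- move=> i j z z1.
  have -> : (fun z : C^o => (b%:C *: rat_evalmx Phi2 z - a%:C *: rat_evalmx Phi1 z) i j : C^o) =
      (fun z : C^o => b%:C * rat_evalmx Phi2 z i j - a%:C * rat_evalmx Phi1 z i j : C^o).
    by apply/funext => x; rewrite !mxE.
  apply: continuousB; (apply: continuousM; first exact: cst_continuous).
    exact: continuous_rat_evalmx (P2 z z1).1.
  exact: continuous_rat_evalmx (P1 z z1).1.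
- move=> z z1; rewrite (P1 z z1).2 (P2 z z1).2.
  by rewrite linearB linearZ linearZ /= map_mxB !map_mxZ /= !conjr !herm.
Qed.

Lemma opbound_mono m n (A : 'M[C]_(m, n)) (l l' : R) : l <= l' ->
  opbound A l -> opbound A l'.
Proof.
move=> ll' bA u w; rewrite (le_trans (bA u w)) // ler_wpM2r ?lecR //.
by rewrite mulr_ge0 ?nsq_ge0.
Qed.

Lemma exists_nsq_gt0 n : (0 < n)%N -> exists v : 'cV[C]_n, 0 < nsq v.
Proof.
case: n => // n _; exists (delta_mx 0 0); apply: nsq_gt0.
by apply/matrix0Pn; exists 0, 0; rewrite mxE !eqxx oner_eq0.
Qed.

(** Where the inverse of W2 can be evaluated, substitute v = W2(z)^-* u.  This leaves
    out finitely many points of the circle; the bound near them excludes poles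
    of the quotient, and then extends by continuity. *)
Lemma dominance_opbound n (W1 W2 : 'M[ratfun R]_n) (l : R) :
  (0 < n)%N -> W2 \in unitmx -> regular_outside W1 -> regular_outside W2 ->
  (forall z, unit_circle z -> forall v : 'cV[C]_n,
    nsq ((rat_evalmx W1 z) ^t* *m v) <= l%:C * nsq ((rat_evalmx W2 z) ^t* *m v)) <->
  0 <= l /\ (forall z, unit_circle z ->
    mx_regular_at (invmx W2 *m W1) z /\ opbound (rat_evalmx (invmx W2 *m W1) z) l).
Proof.
move=> n0 uW2 r1 r2; set G := invmx W2 *m W1.
have rc1 z (z1 : unit_circle z) := regular_outside_circle r1 z1.
have rc2 z (z1 : unit_circle z) := regular_outside_circle r2 z1.
split=> [H|[l0 H] z z1 v]; last first.
  have [rG bG] := H z z1.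
  have W1E : W1 = W2 *m G by rewrite /G mulKVmx.
  rewrite {1}W1E (mulmx_regular_eval (rc2 z z1) rG).2 adj_mul -mulmxA.
  exact: (opboundP _ l0).1 (opbound_adj bG) _.
have [d d0 rV] := regular_generic (invmx W2).
have gen z : unit_circle z -> peval d z != 0 -> mx_regular_at G z /\
    forall u, nsq ((rat_evalmx G z) ^t* *m u) <= l%:C * nsq u.
  move=> z1 dz; have [rG GE] := mulmx_regular_eval (rV z dz) (rc1 z z1).
  split=> // u; have := H z z1 ((rat_evalmx (invmx W2) z) ^t* *m u).
  rewrite !mulmxA -!adj_mul -GE -(mulmx_regular_eval (rV z dz) (rc2 z z1)).2.
  by rewrite mulVmx // rat_evalmx1 trmx1 map_mx1 mul1mx.
have l0 : 0 <= l.
  have n1 : `|1 : C| = 1 by rewrite normr1.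
  have [z [z1 _ dz]] := generically_near_circle n1 ltr01 d0.
  have [v v0] := exists_nsq_gt0 n0.
  have := (gen z z1 dz).2 v => /(le_trans (nsq_ge0 _)).
  by rewrite pmulr_lge0 // lecR.
have bnd z : unit_circle z -> peval d z != 0 -> opbound (rat_evalmx G z) l.
  move=> z1 dz; rewrite -[rat_evalmx G z]trmxCK; apply: opbound_adj.
  by apply/opboundP => //; exact: (gen z z1 dz).2.
split=> // z z1.
have rG : mx_regular_at G z.
  move=> i j; apply: (@bounded_regular _ (@unit_circle R) z d _ (Num.sqrt l)) => //.
    exact: generically_near_circle.
  move=> w w1 dw; have := opbound_entry i j (bnd w w1 dw).
  rewrite mxE modulusE -rmorphXn lecR => b.
  by rewrite -ler_sqr ?nnegrE ?modulus_ge0 ?sqrtr_ge0 // sqr_sqrtr.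
split=> //; apply: (opbound_closure _ d0 rG bnd).
exact: generically_near_circle.
Qed.

(** Compactness of the circle bounds G on it, hence outside the disk, so that the
    supremum is a real number; it is then characterised by the constants that
    bound G on the circle. *)
Lemma Hinf_norm_finite n (G : 'M[ratfun R]_n) : regular_outside G ->
  exists s : R, [/\ 0 <= s, Hinf_norm G = s%:E &
    forall l, 0 <= l ->
      (forall z, unit_circle z -> opbound (rat_evalmx G z) l) <-> s ^+ 2 <= l].
Proof.
move=> rG; have rGc z (z1 : unit_circle z) := regular_outside_circle rG z1.
pose E : set R := [set sigma_max (rat_evalmx G z) | z in [set z : C | 1 < `|z|]].
have [l0 l0_ge0 /(opbound_outside _ rG) b0] := opbound_circle_exists rGc.
have E0 : E !=set0.
  by exists (sigma_max (rat_evalmx G 2)), 2 => //=; rewrite normr_nat ltr1n.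
have Ele l : 0 <= l -> (forall z, 1 < `|z| -> opbound (rat_evalmx G z) l) ->
    ubound E (Num.sqrt l).
  move=> l_ge0 bl _ [z z1 <-].
  rewrite -ler_sqr ?nnegrE ?sqrtr_ge0 ?sigma_max_ge0 // sqr_sqrtr //.
  by apply: sigma_max_le => //; exact: bl.
have Eub : has_ubound E by exists (Num.sqrt l0); exact: Ele.
have s0 : 0 <= sup E.
  have [x Ex] := E0; apply: (@le_trans _ _ x); last exact: ub_le_sup.
  by have [z _ <-] := Ex; exact: sigma_max_ge0.
exists (sup E); split=> //.
  rewrite /Hinf_norm -ereal_sup_EFin //; congr ereal_sup.
  by rewrite /E image_comp.
move=> l l_ge0; rewrite (opbound_outside _ rG); split=> [bl|sl z z1].
  by rewrite -(sqr_sqrtr l_ge0) ler_sqr ?nnegrE ?sqrtr_ge0 //; apply: ge_sup => //; exact: Ele.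
apply: (opbound_mono _ (opbound_sigma_max _)); apply: le_trans sl.
rewrite ler_sqr ?nnegrE ?sigma_max_ge0 //.
by apply: ub_le_sup => //; exists z.
Qed.

Lemma ereal_inf_ray (x : R) : ereal_inf [set l%:E | l in [set l : R | x <= l]] = x%:E.
Proof.
apply/eqP; rewrite eq_le; apply/andP; split.
  by apply: ereal_inf_lbound; exists x => //=.
by apply: le_ereal_inf_tmp => _ [l xl <-]; rewrite lee_fin.
Qed.

Lemma ereal_sup_ray (x : R) : ereal_sup [set l%:E | l in [set l : R | l <= x]] = x%:E.
Proof.
apply/eqP; rewrite eq_le; apply/andP; split.
  by apply: ge_ereal_sup => _ [l xl <-]; rewrite lee_fin.
by apply: ereal_sup_ubound; exists x => //=.
Qed.

End Dominance.

(** * The two metrics *)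

Section Metrics.
Variable R : realType.
Local Notation C := R[i].
Local Open Scope sesquilinear_scope.

Lemma invmx_quotient (F : fieldType) n (W1 W2 : 'M[F]_n) : W1 \in unitmx -> W2 \in unitmx ->
  [/\ invmx W2 *m W1 \in unitmx, invmx (invmx W2 *m W1) = invmx W1 *m W2 &
      (invmx W1 *m W2) *m (invmx W2 *m W1) = 1%:M].
Proof.
move=> u1 u2; have uG : invmx W2 *m W1 \in unitmx by rewrite unitmx_mul unitmx_inv u2 u1.
have HG : (invmx W1 *m W2) *m (invmx W2 *m W1) = 1%:M.
  by rewrite mulmxA -[_ *m W2 *m _]mulmxA (mulmxV u2) mulmx1 (mulVmx u1).
split; [exact: uG| |exact: HG].
by rewrite -[LHS]mul1mx -HG (mulmxK uG).
Qed.

Lemma quotient_regular_outside n (W1 W2 : 'M[ratfun R]_n) :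
  minimum_phase W1 -> minimum_phase W2 ->
  (forall z, unit_circle z -> mx_regular_at (invmx W2 *m W1) z) ->
  regular_outside (invmx W2 *m W1).
Proof.
move=> /minimum_phase_regular[[r1 r10] _] /minimum_phase_regular[_ [i2 i20]] rc.
split=> [z|].
  rewrite le_eqVlt => /orP[/eqP z1|z1]; first by apply: rc; rewrite /unit_circle /= -z1.
  by apply: (mulmx_regular_eval (i2 z z1) (r1 z (ltW z1))).1.
by rewrite map_rat_recipM; exact: (mulmx_regular_eval i20 r10).1.
Qed.

Lemma Sle_opbound n (Phi1 Phi2 W1 W2 : 'M[ratfun R]_n) (l : R) : (0 < n)%N ->
  spectral_factor Phi1 W1 -> minimum_phase W1 ->
  spectral_factor Phi2 W2 -> minimum_phase W2 -> W2 \in unitmx ->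
  Sle (rat_evalmx Phi1) (Sscale l (rat_evalmx Phi2)) <->
  0 <= l /\ (forall z, unit_circle z ->
    mx_regular_at (invmx W2 *m W1) z /\ opbound (rat_evalmx (invmx W2 *m W1) z) l).
Proof.
move=> n0 f1 m1 f2 m2 u2.
have [r1 _] := minimum_phase_regular m1; have [r2 _] := minimum_phase_regular m2.
have one (z : C) : Sscale l (rat_evalmx Phi2) z - rat_evalmx Phi1 z =
    l%:C *: rat_evalmx Phi2 z - 1%:C *: rat_evalmx Phi1 z by rewrite /Sscale scale1r.
rewrite /Sle (funext one) (Sle_pointwise _ _ f1 r1 f2 r2).
rewrite -(dominance_opbound _ n0 u2 r1 r2).
by split=> H z z1 v; have := H z z1 v; rewrite mul1r.
Qed.

Lemma Hinf_norm_bounds n (Phi1 Phi2 W1 W2 : 'M[ratfun R]_n) : (0 < n)%N ->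
  spectral_factor Phi1 W1 -> minimum_phase W1 ->
  spectral_factor Phi2 W2 -> minimum_phase W2 -> W2 \in unitmx ->
  (forall z, unit_circle z -> mx_regular_at (invmx W2 *m W1) z) ->
  exists s : R, [/\ 0 <= s, Hinf_norm (invmx W2 *m W1) = s%:E,
    forall l, Sle (rat_evalmx Phi1) (Sscale l (rat_evalmx Phi2)) <-> s ^+ 2 <= l &
    (exists2 z, unit_circle z & rat_evalmx (invmx W2 *m W1) z != 0) -> 0 < s].
Proof.
move=> n0 f1 m1 f2 m2 u2 rc.
have [s [s0 sE sP]] := Hinf_norm_finite (quotient_regular_outside m1 m2 rc).
exists s; split=> // [l|[z z1 Gz]].
  rewrite (Sle_opbound _ n0 f1 m1 f2 m2 u2); split=> [[l0 H]|sl].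
    by apply/sP => // z z1; exact: (H z z1).2.
  have l0 : 0 <= l by exact: le_trans (sqr_ge0 s) sl.
  by split=> // z z1; split; [exact: rc|apply: ((sP l l0).2 sl)].
rewrite lt0r s0 andbT; apply: contra_neq Gz => s_eq0.
have b0 : opbound (rat_evalmx (invmx W2 *m W1) z) 0.
  by apply: ((sP 0 (lexx 0)).2 _ z z1); rewrite s_eq0 expr0n.
apply/matrixP => i j; rewrite [RHS]mxE; apply/eqP.
rewrite -normr_eq0 -sqrf_eq0 eq_le exprn_ge0 // andbT.
exact: opbound_entry i j b0.
Qed.

(** For l > 0, l Phi2 <= Phi1 means Phi2 <= l^-1 Phi1; for l <= 0 it always holds. *)
Lemma lowermE n (Phi1 Phi2 W1 W2 : 'M[ratfun R]_n) (s : R) : 0 < s ->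
  spectral_factor Phi1 W1 -> regular_outside W1 ->
  spectral_factor Phi2 W2 -> regular_outside W2 ->
  (forall l, Sle (rat_evalmx Phi2) (Sscale l (rat_evalmx Phi1)) <-> s ^+ 2 <= l) ->
  lowerm (rat_evalmx Phi1) (rat_evalmx Phi2) = (s ^+ 2)^-1%:E.
Proof.
move=> s0 f1 r1 f2 r2 sP; have s20 : 0 < s ^+ 2 by rewrite exprn_gt0.
rewrite /lowerm -ereal_sup_ray; congr (ereal_sup (_ @` _)); apply/seteqP.
have E (l : R) : Sle (Sscale l (rat_evalmx Phi2)) (rat_evalmx Phi1) <->
    forall z, unit_circle z -> forall v : 'cV[C]_n,
    l%:C * nsq ((rat_evalmx W2 z) ^t* *m v) <= 1%:C * nsq ((rat_evalmx W1 z) ^t* *m v).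
  rewrite -(Sle_pointwise _ _ f2 r2 f1 r1) /Sle.
  suff -> : (fun z => rat_evalmx Phi1 z - Sscale l (rat_evalmx Phi2) z) =
    (fun z => 1%:C *: rat_evalmx Phi1 z - l%:C *: rat_evalmx Phi2 z) by [].
  by apply/funext => z; rewrite scale1r.
have E' (l : R) : Sle (rat_evalmx Phi2) (Sscale l (rat_evalmx Phi1)) <->
    forall z, unit_circle z -> forall v : 'cV[C]_n,
    1%:C * nsq ((rat_evalmx W2 z) ^t* *m v) <= l%:C * nsq ((rat_evalmx W1 z) ^t* *m v).
  rewrite -(Sle_pointwise _ _ f2 r2 f1 r1) /Sle.
  suff -> : (fun z => Sscale l (rat_evalmx Phi1) z - rat_evalmx Phi2 z) =
    (fun z => l%:C *: rat_evalmx Phi1 z - 1%:C *: rat_evalmx Phi2 z) by [].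
  by apply/funext => z; rewrite scale1r.
have inv (l : R) : 0 < l -> Sle (Sscale l (rat_evalmx Phi2)) (rat_evalmx Phi1) <->
    Sle (rat_evalmx Phi2) (Sscale l^-1 (rat_evalmx Phi1)).
  move=> l0; have lC : 0 < l%:C :> C by rewrite ltcR.
  rewrite E E'; split=> H z z1 v; have := H z z1 v; rewrite fmorphV !mul1r.
    by rewrite ler_pdivlMl.
  by rewrite ler_pdivlMl.
have key (l : R) : Sle (Sscale l (rat_evalmx Phi2)) (rat_evalmx Phi1) <-> l <= (s ^+ 2)^-1.
  have [l0|l0] := ltP 0 l.
    have -> : (l <= (s ^+ 2)^-1) = (s ^+ 2 <= l^-1).
      by rewrite -[l in LHS]invrK lef_pV2 // posrE invr_gt0.
    by rewrite inv // sP.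
  split=> [_|_]; first by rewrite (le_trans l0) // invr_ge0 ltW.
  apply/E => z z1 v; rewrite (@le_trans _ _ 0) ?mul1r ?nsq_ge0 //.
  by rewrite mulr_le0_ge0 ?nsq_ge0 // lecR.
by split=> l /key.
Qed.

Lemma upperME n (Phi Psi : C -> 'M[C]_n) (x : R) :
  (forall l, Sle Phi (Sscale l Psi) <-> x <= l) -> upperM Phi Psi = x%:E.
Proof.
move=> H; rewrite /upperM -ereal_inf_ray; congr (ereal_inf (_ @` _)).
by apply/seteqP; split=> l /H.
Qed.

End Metrics.

Theorem theorem1 (R : realType) (n : nat) (n_gt0 : (0 < n)%N)
  (Phi1 Phi2 : 'M[ratfun R]_n)
  (Phi1_S : Splus_rat Phi1) (Phi2_S : Splus_rat Phi2)
  (Phi1_rank : normal_rank (rat_evalmx Phi1) n)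
  (Phi2_rank : normal_rank (rat_evalmx Phi2) n)
  (W1 W2 : 'M[ratfun R]_n)
  (W1_factor : spectral_factor Phi1 W1) (W1_mp : minimum_phase W1)
  (W2_factor : spectral_factor Phi2 W2) (W2_mp : minimum_phase W2) :
  let G := invmx W2 *m W1 in
  let H := invmx W1 *m W2 in
  let dH := hilbert_metric (rat_evalmx Phi1) (rat_evalmx Phi2) in
  let dT := thompson_metric (rat_evalmx Phi1) (rat_evalmx Phi2) in
  ((forall z : R[i], unit_circle z -> ~ is_zero G z /\ ~ is_pole G z) ->
     dH = lne (Hinf_norm G ^+ 2 * Hinf_norm H ^+ 2)%E /\
     dT = lne (maxe (Hinf_norm G ^+ 2) (Hinf_norm H ^+ 2))%E) /\
  ((exists2 z : R[i], unit_circle z & is_zero G z \/ is_pole G z) ->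
     dH = +oo%E /\ dT = +oo%E).
Proof.
move=> G H dH dT.
have [r1 _] := minimum_phase_regular W1_mp; have [r2 _] := minimum_phase_regular W2_mp.
have u1 := spectral_factor_unit W1_factor r1 Phi1_rank.
have u2 := spectral_factor_unit W2_factor r2 Phi2_rank.
have [uG GV HG] := invmx_quotient u1 u2.
split=> [npz|[z z1 pz]].
  have rGH z (z1 : unit_circle z) := no_pole_zero_regular uG (npz z z1).1 (npz z z1).2.
  rewrite GV in rGH.
  have rG z (z1 : unit_circle z) := (rGH z z1).1.
  have rH z (z1 : unit_circle z) := (rGH z z1).2.
  have [s [s0 sE sP _]] :=
    Hinf_norm_bounds n_gt0 W1_factor W1_mp W2_factor W2_mp u2 rG.
  have [t [t0 tE tP tpos]] :=
    Hinf_norm_bounds n_gt0 W2_factor W2_mp W1_factor W1_mp u1 rH.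
  have {tpos} t_gt0 : 0 < t.
    have c1 : unit_circle (1 : R[i]) by rewrite /unit_circle /= normr1.
    apply: tpos; exists 1 => //; apply/eqP => H0.
    have := (mulmx_regular_eval (rH 1 c1) (rG 1 c1)).2.
    rewrite HG H0 mul0mx rat_evalmx1 => /matrixP/(_ (Ordinal n_gt0) (Ordinal n_gt0)).
    by rewrite !mxE eqxx => /eqP; rewrite oner_eq0.
  have equiv : Sequiv (rat_evalmx Phi1) (rat_evalmx Phi2).
    exists (s ^+ 2 + 1), (t ^+ 2 + 1); split.
    - by rewrite ltr_wpDl ?sqr_ge0.
    - by rewrite ltr_wpDl ?sqr_ge0.
    - by apply/sP; rewrite lerDl.
    - by apply/tP; rewrite lerDl.
  rewrite /dH /dT /hilbert_metric /thompson_metric asboolT // sE tE.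
  rewrite (upperME sP) (upperME tP) (lowermE t_gt0 W1_factor r1 W2_factor r2 tP).
  rewrite inver invr_eq0 gt_eqF ?exprn_gt0 // invrK.
  by rewrite -!EFin_expe.
suff nequiv : ~ Sequiv (rat_evalmx Phi1) (rat_evalmx Phi2).
  by rewrite /dH /dT /hilbert_metric /thompson_metric asboolF.
move=> [b [b' [_ _ le12 le21]]].
have [_ /(_ z z1)[rG _]] :=
  (Sle_opbound b n_gt0 W1_factor W1_mp W2_factor W2_mp u2).1 le12.
have [_ /(_ z z1)[rH _]] :=
  (Sle_opbound b' n_gt0 W2_factor W2_mp W1_factor W1_mp u1).1 le21.
case: pz => [|]; last exact: regular_pole.
by apply: regular_zero => //; rewrite GV.
Qed.
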